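(* Let $H_1,H_2$ be Hermitian matrices, $f_1,f_2:[0,T]\to\mathbb{R}$ with $f_j,f_j',f_j''$ bounded and continuous, $H(t)=f_1(t)H_1+f_2(t)H_2$. Assume $H_1=D_1^\dagger D_1$ for some matrix $D_1$ and that there are constants $\widetilde C_1,\widetilde C_2\ge0$ with $\|[H_1,H_2]\vec v\|\le\widetilde C_1(\|D_1\vec v\|+\|\vec v\|)$ and $\|[H_1,[H_1,H_2]]\vec v\|\le\widetilde C_2(\|H_1\vec v\|+\|\vec v\|)$ for all $\vec v$. Let $\vec\psi(t)=U(t,0)\vec\psi(0)$ be the exact solution, $L$ an integer with $h=T/L\le(\|f_1\|_\infty+\|f_2\|_\infty)^{-1}(\widetilde C_1+\|H_2\|)^{-1}/2$, and for each scheme $X\in\{(s,1),(g,1),(s,2),(g,2)\}$ let $\mathcal U_X=U_X(T,\tfrac{(L-1)T}{L})\cdots U_X(\tfrac TL,0)$. Then there exists a constant $\widetilde C$ (independent of $H_1$, $L$, $\vec\psi$) such that $$\|\mathcal U_{s,1}\vec\psi(0)-U(T,0)\vec\psi(0)\|\le\widetilde C\tfrac{T^2}{L}\Big(\sup_{t\in[0,T]}\|H_1\vec\psi(t)\|+\|\vec\psi(0)\|\Big),$$ $$\|\mathcal U_{g,1}\vec\psi(0)-U(T,0)\vec\psi(0)\|\le\widetilde C\tfrac{T^2}{L}\Big(\sup_{t\in[0,T]}\sqrt{\|\vec\psi(0)\|\|H_1\vec\psi(t)\|}+\|\vec\psi(0)\|\Big),$$ $$\|\mathcal U_{s,2}\vec\psi(0)-U(T,0)\vec\psi(0)\|\le\widetilde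 C\tfrac{T^3}{L^2}\Big(\sup_{t\in[0,T]}\|H_1\vec\psi(t)\|+\|\vec\psi(0)\|\Big),$$ $$\|\mathcal U_{g,2}\vec\psi(0)-U(T,0)\vec\psi(0)\|\le\widetilde C\tfrac{T^3}{L^2}\Big(\sup_{t\in[0,T]}\|H_1\vec\psi(t)\|+\|\vec\psi(0)\|\Big).$$
   Context: $\|\cdot\|$ is the vector 2-norm / induced operator norm, $\|f\|_\infty=\sup_{[0,T]}|f|$. The constant $\widetilde C$ may depend polynomially on $\|H_2\|$, $\|f_j^{(k)}\|_\infty$ ($k\le2$) and on $\widetilde C_1,\widetilde C_2$, but not on $H_1$. $U(t,s)$ is the exact evolution: $\partial_tU(t,s)=-\mathrm{i} H(t)U(t,s)$, $U(s,s)=I$. Trotter steps: $U_{s,1}(t+h,t)=\exp(-\mathrm{i} f_2(t+h)H_2h)\exp(-\mathrm{i} f_1(t+h)H_1h)$; $U_{g,1}(t+h,t)=\exp(-\mathrm{i}\int_t^{t+h}f_2(s)ds\,H_2)\exp(-\mathrm{i}\int_t^{t+h}f_1(s)ds\,H_1)$; $U_{s,2}(t+h,t)=\exp(-\frac{\mathrm{i} h}{2}f_1(t+h/2)H_1)\exp(-\mathrm{i} hf_2(t+h/2)H_2)\exp(-\frac{\mathrm{i} h}{2}f_1(t+h/2)H_1)$; $U_{g,2}(t+h,t)=\exp(-\mathrm{i}\int_{t+h/2}^{t+h}f_1(s)ds\,H_1)\exp(-\mathrm{i}\int_t^{t+h}f_2(s)ds\,H_2)\exp(-\mathrm{i}\int_t^{t+h/2}f_1(s)ds\,H_1)$.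 *)

(* Defs.v *)
From mathcomp Require Import all_boot all_algebra complex.
From mathcomp Require Import all_classical all_reals all_analysis.
Import GRing.Theory Num.Theory.
Import numFieldNormedType.Exports.

Set Implicit Arguments.
Unset Strict Implicit.
Unset Printing Implicit Defensive.

Local Open Scope classical_set_scope.
Local Open Scope ring_scope.

Section Defs.
Variable R : realType.

Definition cI : R[i] := Complex 0 1.
Definition cR (x : R) : R[i] := Complex x 0.
Definition cabs2 (z : R[i]) : R := complex.Re z ^+ 2 + complex.Im z ^+ 2.

Definition vnorm n (v : 'cV[R[i]]_n) : R := Num.sqrt (\sum_i cabs2 (v i 0)).

Definition opnorm m n (A : 'M[R[i]]_(m, n)) : R :=
  sup [set vnorm (A *m v) | v in [set v : 'cV[R[i]]_n | vnorm v <= 1]].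

Definition mx_adj m n (A : 'M[R[i]]_(m, n)) : 'M[R[i]]_(n, m) :=
  (map_mx (@conjc R) A)^T.
Definition is_hermitian n (A : 'M[R[i]]_n) : Prop := mx_adj A = A.
Definition mxcomm n (A B : 'M[R[i]]_n) : 'M[R[i]]_n := A *m B - B *m A.

Definition Re_mx m n (A : 'M[R[i]]_(m, n)) : 'M[R]_(m, n) := map_mx (@complex.Re R) A.
Definition Im_mx m n (A : 'M[R[i]]_(m, n)) : 'M[R]_(m, n) := map_mx (@complex.Im R) A.

Definition mxpow n (A : 'M[R[i]]_n) (k : nat) : 'M[R[i]]_n := iter k (mulmx A) 1%:M.
Definition expm n (A : 'M[R[i]]_n) : 'M[R[i]]_n :=
  \matrix_(i, j)
    Complex (limn (fun N => \sum_(k < N) complex.Re (mxpow A k i j) / (k`!)%:R))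
            (limn (fun N => \sum_(k < N) complex.Im (mxpow A k i j) / (k`!)%:R)).

Definition expmi n (c : R) (A : 'M[R[i]]_n) : 'M[R[i]]_n := expm (- (cI * cR c) *: A).

Definition supnorm (T : R) (f : R -> R) : R := sup [set `|f t| | t in `[0, T]].

Definition C2_on (T : R) (f df ddf : R -> R) : Prop :=
  [/\ {within `[0, T], continuous f},
      {within `[0, T], continuous df},
      {within `[0, T], continuous ddf},
      (forall t, t \in `]0, T[ -> is_derive t 1 f (df t) /\ is_derive t 1 df (ddf t))
    & exists M : R, forall t, t \in `[0, T] ->
        [/\ `|f t| <= M, `|df t| <= M & `|ddf t| <= M]].

Definition Rint (a b : R) (f : R -> R) : R := Rintegral lebesgue_measure `[a, b] f.

Definition Ham n (f1 f2 : R -> R) (H1 H2 : 'M[R[i]]_n) (t : R) : 'M[R[i]]_n :=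
  cR (f1 t) *: H1 + cR (f2 t) *: H2.

(* U t = U(t,0) is the exact evolution on [0,T]:
   d/dt U(t,0) = -i H(t) U(t,0),  U(0,0) = I  (real and imaginary parts) *)
Definition is_evolution n (T : R) (H : R -> 'M[R[i]]_n) (U : R -> 'M[R[i]]_n) : Prop :=
  [/\ U 0 = 1%:M,
      {within `[0, T], continuous (fun t => Re_mx (U t))},
      {within `[0, T], continuous (fun t => Im_mx (U t))}
    & forall t, t \in `]0, T[ ->
        is_derive t 1 (fun s => Re_mx (U s)) (Re_mx (- cI *: (H t *m U t))) /\
        is_derive t 1 (fun s => Im_mx (U s)) (Im_mx (- cI *: (H t *m U t)))].

Definition U_s1 n (f1 f2 : R -> R) (H1 H2 : 'M[R[i]]_n) (h t : R) :=
  expmi (f2 (t + h) * h) H2 *m expmi (f1 (t + h) * h) H1.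
Definition U_g1 n (f1 f2 : R -> R) (H1 H2 : 'M[R[i]]_n) (h t : R) :=
  expmi (Rint t (t + h) f2) H2 *m expmi (Rint t (t + h) f1) H1.
Definition U_s2 n (f1 f2 : R -> R) (H1 H2 : 'M[R[i]]_n) (h t : R) :=
  expmi (h / 2 * f1 (t + h / 2)) H1 *m expmi (h * f2 (t + h / 2)) H2
    *m expmi (h / 2 * f1 (t + h / 2)) H1.
Definition U_g2 n (f1 f2 : R -> R) (H1 H2 : 'M[R[i]]_n) (h t : R) :=
  expmi (Rint (t + h / 2) (t + h) f1) H1 *m expmi (Rint t (t + h) f2) H2
    *m expmi (Rint t (t + h / 2) f1) H1.

(* product  step((L-1)h) ... step(h) step(0),  where step t = U_X(t+h,t) *)
Fixpoint trotter n (step : R -> 'M[R[i]]_n) (h : R) (L : nat) : 'M[R[i]]_n :=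
  match L with
  | 0 => 1%:M
  | L'.+1 => step (L'%:R * h) *m trotter step h L'
  end.

End Defs.

(* Main.v *)
Require Import Defs.
From mathcomp Require Import all_boot all_order all_algebra complex.
From mathcomp Require Import all_classical all_reals all_analysis.
From mathcomp Require Import ring lra.
Import Order.TTheory GRing.Theory Num.Theory.
Import numFieldNormedType.Exports.

(* On a step [[t, t + h]] write the scheme as [E1(p) E2(q) E1(al)], with
   [Ej(c) = exp(-i c Hj)], and let [Fj] be antiderivatives of [fj].  With
   [th(s) = F1(s) - F1(t) - al] and [be(s) = F2(s) - F2(t)], pass to
   [u = E1(-th) psi] and [y = E2(-be) u]: the unbounded part of the equation
   cancels, leaving
     [y' = -i f2 E2(-be) (E1(-th) H2 E1(th) - H2) u].
   By unitarity the local error is [|y(t+h) - y(t)|] plus the quadrature errors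
   of [p + al] and [q], the former multiplied by [|H1 psi|].  The conjugation
   difference is [O(th) [H1, H2]], controlled by [|D1 psi|^2 <= |psi| |H1 psi|]
   since [H1 = D1^* D1] commutes with [E1]; this gives first order.  For second
   order the difference is [i th [H1, H2] + O(th^2) [H1, [H1, H2]]] and, [th]
   being odd around the midpoint up to [O(h^2)], the leading term is removed by
   subtracting [c(s) E2(-be) [H1, H2] u] with [c] a quadratic vanishing at both
   ends of the step.  Isometry of the steps lets the local errors add up. *)

Set Implicit Arguments.
Unset Strict Implicit.
Unset Printing Implicit Defensive.

Local Open Scope classical_set_scope.
Local Open Scope ring_scope.

(** * Euclidean geometry of complex column vectors, and operator norms *)

Section ComplexEuclidean.
Variable R : realType.
Local Notation C := R[i].
Local Notation Re := (@complex.Re R).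
Local Notation Im := (@complex.Im R).

Lemma ReCD (x y : C) : Re (x + y) = Re x + Re y.
Proof. by case: x; case: y. Qed.

Lemma ImCD (x y : C) : Im (x + y) = Im x + Im y.
Proof. by case: x; case: y. Qed.

Lemma ReCN (x : C) : Re (- x) = - Re x. Proof. by case: x. Qed.

Lemma ImCN (x : C) : Im (- x) = - Im x. Proof. by case: x. Qed.

Lemma ReCM (x y : C) : Re (x * y) = Re x * Re y - Im x * Im y.
Proof. by case: x; case: y. Qed.

Lemma ImCM (x y : C) : Im (x * y) = Re x * Im y + Im x * Re y.
Proof. by case: x; case: y. Qed.

Lemma Re_sum (I : Type) (r : seq I) (P : pred I) (F : I -> C) :
  Re (\sum_(i <- r | P i) F i) = \sum_(i <- r | P i) Re (F i).
Proof. by apply: (big_morph Re ReCD). Qed.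

Lemma Im_sum (I : Type) (r : seq I) (P : pred I) (F : I -> C) :
  Im (\sum_(i <- r | P i) F i) = \sum_(i <- r | P i) Im (F i).
Proof. by apply: (big_morph Im ImCD). Qed.

Lemma complex_ext (x y : C) : Re x = Re y -> Im x = Im y -> x = y.
Proof. by case: x y => [a b] [c d] /= -> ->. Qed.

Lemma cRE (x : R) : cR x = x%:C%C. Proof. by []. Qed.

Lemma cRM (x y : R) : cR (x * y) = cR x * cR y.
Proof. by rewrite !cRE rmorphM. Qed.

Lemma cRD (x y : R) : cR (x + y) = cR x + cR y.
Proof. by rewrite !cRE rmorphD. Qed.

Lemma cRN (x : R) : cR (- x) = - cR x.
Proof. by rewrite !cRE rmorphN. Qed.

Lemma cR0 : cR 0 = 0 :> C. Proof. by []. Qed.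

Lemma cR1 : cR 1 = 1 :> C. Proof. by []. Qed.

Lemma cIcI : cI R * cI R = -1.
Proof. by rewrite /cI -(@sqr_i R) expr2. Qed.

Lemma mx_adjM m n p (A : 'M[C]_(m, n)) (B : 'M[C]_(n, p)) :
  mx_adj (A *m B) = mx_adj B *m mx_adj A.
Proof. by rewrite /mx_adj map_mxM trmx_mul. Qed.

Lemma mx_adjD m n (A B : 'M[C]_(m, n)) : mx_adj (A + B) = mx_adj A + mx_adj B.
Proof. by apply/matrixP => i j; rewrite !mxE rmorphD. Qed.

Lemma mx_adjZ m n (z : C) (A : 'M[C]_(m, n)) :
  mx_adj (z *: A) = conjc z *: mx_adj A.
Proof. by apply/matrixP => i j; rewrite !mxE rmorphM. Qed.

Lemma mx_adjK m n (A : 'M[C]_(m, n)) : mx_adj (mx_adj A) = A.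
Proof. by apply/matrixP => i j; rewrite !mxE conjcK. Qed.

(* The real part of the complex inner product: a real inner product on [C^n]
   whose norm is [vnorm]. *)
Definition rdot n (u v : 'cV[C]_n) : R := Re ((mx_adj u *m v) 0 0).

Section Rdot.
Variable n : nat.
Implicit Types u v w : 'cV[C]_n.

Lemma rdotE u v :
  rdot u v = \sum_i (Re (u i 0) * Re (v i 0) + Im (u i 0) * Im (v i 0)).
Proof.
rewrite /rdot mxE Re_sum; apply: eq_bigr => i _; rewrite !mxE ReCM.
by case: (u i 0) => a b /=; rewrite mulNr opprK.
Qed.

Lemma rdotC u v : rdot u v = rdot v u.
Proof. by rewrite !rdotE; apply: eq_bigr => i _; ring. Qed.

Lemma rdotDr u v w : rdot u (v + w) = rdot u v + rdot u w.
Proof. by rewrite /rdot mulmxDr mxE ReCD. Qed.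

Lemma rdotNr u v : rdot u (- v) = - rdot u v.
Proof. by rewrite /rdot mulmxN mxE ReCN. Qed.

Lemma rdotBr u v w : rdot u (v - w) = rdot u v - rdot u w.
Proof. by rewrite rdotDr rdotNr. Qed.

Lemma rdotZr (x : R) u v : rdot u (cR x *: v) = x * rdot u v.
Proof. by rewrite /rdot -scalemxAr mxE ReCM /= mul0r subr0. Qed.

Lemma rdotDl u v w : rdot (u + v) w = rdot u w + rdot v w.
Proof. by rewrite !(rdotC _ w) rdotDr. Qed.

Lemma rdotZl (x : R) u v : rdot (cR x *: u) v = x * rdot u v.
Proof. by rewrite !(rdotC _ v) rdotZr. Qed.

Lemma rdotvv u : rdot u u = \sum_i cabs2 (u i 0).
Proof. by rewrite rdotE; apply: eq_bigr => i _; rewrite /cabs2 !expr2. Qed.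

Lemma rdot_ge0 u : 0 <= rdot u u.
Proof.
by rewrite rdotvv sumr_ge0// => i _; rewrite addr_ge0// sqr_ge0.
Qed.

Lemma vnormE u : vnorm u = Num.sqrt (rdot u u).
Proof. by rewrite rdotvv. Qed.

Lemma vnorm_ge0 u : 0 <= vnorm u. Proof. exact: sqrtr_ge0. Qed.

Lemma vnorm_sqr u : vnorm u ^+ 2 = rdot u u.
Proof. by rewrite vnormE sqr_sqrtr// rdot_ge0. Qed.

Lemma vnorm_eq0 u : vnorm u = 0 -> u = 0.
Proof.
move=> u0; have := vnorm_sqr u; rewrite u0 expr0n /= rdotvv => /esym/eqP.
rewrite psumr_eq0; last by move=> i _; rewrite addr_ge0// sqr_ge0.
move/allP => H; apply/matrixP => i j; rewrite ord1 mxE.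
have := H i (mem_index_enum _); rewrite /cabs2 /=.
rewrite paddr_eq0 ?sqr_ge0// !sqrf_eq0 => /andP[/eqP a /eqP b].
exact: complex_ext.
Qed.

Lemma vnorm_le_sqr u (x : R) : 0 <= x -> rdot u u <= x ^+ 2 -> vnorm u <= x.
Proof.
by move=> x0; rewrite -vnorm_sqr ler_pXn2r// nnegrE ?vnorm_ge0.
Qed.

(** Cauchy-Schwarz, by expanding [|b^2 u - d v|^2 = b^2 (a^2 b^2 - d^2) >= 0], where [a], [b] are
    the two norms and [d] is the inner product. *)
Lemma rdot_le u v : rdot u v <= vnorm u * vnorm v.
Proof.
have [v0|v0] := eqVneq (vnorm v) 0.
  rewrite v0 mulr0 (vnorm_eq0 v0) /rdot mulmx0 mxE.
  by rewrite raddf0.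
have vp : 0 < vnorm v by rewrite lt_def v0 vnorm_ge0.
have [d0|d0] := ltP (rdot u v) 0.
  by rewrite (le_trans (ltW d0))// mulr_ge0 ?vnorm_ge0.
have V := vnorm_sqr v; have U := vnorm_sqr u.
have := rdot_ge0 (cR (vnorm v ^+ 2) *: u - cR (rdot u v) *: v).
rewrite -scaleNr -cRN rdotDr !rdotZr !rdotDl !rdotZl -!U -!V (rdotC v u).
set a := vnorm u; set b := vnorm v; set d := rdot u v => H.
have {}H : 0 <= b ^+ 2 * ((a * b) ^+ 2 - d ^+ 2).
  by apply: le_trans H _; rewrite le_eqVlt; apply/orP; left; apply/eqP; ring.
rewrite pmulr_rge0 ?exprn_gt0// subr_ge0 in H.
by move: H; rewrite ler_pXn2r// nnegrE ?mulr_ge0 ?vnorm_ge0.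
Qed.

Lemma vnormD u v : vnorm (u + v) <= vnorm u + vnorm v.
Proof.
apply: vnorm_le_sqr; first by rewrite addr_ge0 ?vnorm_ge0.
rewrite rdotDr !rdotDl (rdotC v u) -!vnorm_sqr.
by have := rdot_le u v; lra.
Qed.

Lemma vnormZ (z : C) u : vnorm (z *: u) = Num.sqrt (cabs2 z) * vnorm u.
Proof.
rewrite /vnorm -sqrtrM; last by rewrite addr_ge0// sqr_ge0.
congr Num.sqrt; rewrite mulr_sumr; apply: eq_bigr => i _.
by rewrite mxE /cabs2 ReCM ImCM; ring.
Qed.

Lemma vnormZR (x : R) u : vnorm (cR x *: u) = `|x| * vnorm u.
Proof. by rewrite vnormZ /cabs2 /= expr0n addr0 sqrtr_sqr. Qed.

Lemma vnormZI u : vnorm (cI R *: u) = vnorm u.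
Proof. by rewrite vnormZ /cabs2 /= expr0n add0r expr1n sqrtr1 mul1r. Qed.

Lemma vnormN u : vnorm (- u) = vnorm u.
Proof.
rewrite /vnorm; congr Num.sqrt; apply: eq_bigr => i _.
by rewrite mxE /cabs2 ReCN ImCN !sqrrN.
Qed.

Lemma vnormB u v : vnorm (u - v) <= vnorm u + vnorm v.
Proof. by rewrite -(vnormN v) vnormD. Qed.

Lemma vnorm_distC u v : vnorm (u - v) = vnorm (v - u).
Proof. by rewrite -opprB vnormN. Qed.

Lemma vnorm0 : vnorm (0 : 'cV[C]_n) = 0.
Proof. by rewrite vnormE /rdot mulmx0 mxE sqrtr0. Qed.

End Rdot.

Lemma rdot_adj m n (A : 'M[C]_(m, n)) (u : 'cV[C]_n) (v : 'cV[C]_m) :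
  rdot (A *m u) v = rdot u (mx_adj A *m v).
Proof. by rewrite /rdot mx_adjM mulmxA. Qed.

(** Moving [-iA] across the inner product flips its sign, so the quantity is its own negative. Every
    conservation of norm below rests on this. *)
Lemma rdot_antiherm n (A : 'M[C]_n) (u : 'cV[C]_n) :
  is_hermitian A -> rdot u (- cI R *: (A *m u)) = 0.
Proof.
move=> hA; set x := rdot _ _; suff: x = - x by lra.
rewrite {1}/x scalemxAl.
rewrite rdotC rdot_adj mx_adjZ hA -rdotNr; congr (rdot u _).
by rewrite -scalemxAl -scaleNr; congr (_ *: _); apply: complex_ext => /=; ring.
Qed.

Section Opnorm.
Variables m n : nat.
Implicit Types A : 'M[C]_(m, n).

Lemma vnorm_mulmx_bounded A :
  exists2 K : R, 0 <= K & forall v, vnorm (A *m v) <= K * vnorm v.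
Proof.
(* Each squared row norm counts twice because the real and imaginary parts of an entry of [A v] are
   bounded separately, the latter by pairing with [i v]. *)
pose K := \sum_i vnorm (mx_adj (row i A)) ^+ 2 * 2.
have K0 : 0 <= K by apply: sumr_ge0 => i _; rewrite mulr_ge0// sqr_ge0.
exists (Num.sqrt K) => [|v]; first exact: sqrtr_ge0.
apply: vnorm_le_sqr; first by rewrite mulr_ge0 ?sqrtr_ge0 ?vnorm_ge0.
rewrite exprMn sqr_sqrtr// rdotvv mulr_suml; apply: ler_sum => i _.
set r := mx_adj (row i A).
have e : (A *m v) i 0 = (mx_adj r *m v) 0 0.
  by rewrite /r mx_adjK -row_mul [RHS]mxE.
have b w : Re ((mx_adj r *m w) 0 0) ^+ 2 <= (vnorm r * vnorm w) ^+ 2.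
  have h1 := rdot_le r w; have h2 := rdot_le r (- w).
  rewrite vnormN rdotNr in h2.
  rewrite -real_normK ?num_real// ler_pXn2r ?nnegrE ?mulr_ge0 ?vnorm_ge0//.
  by rewrite ler_norml -/(rdot r w); apply/andP; split; lra.
have := b v; have := b (cI R *: v); rewrite vnormZI -scalemxAr mxE ReCM /= -e.
rewrite mul0r mul1r sub0r sqrrN /cabs2 !exprMn => h1 h2.
by rewrite mulrAC -mulrA; lra.
Qed.

(** Guarantees that the [sup] in [opnorm] is a genuine least upper bound and not a default value. *)
Lemma opnorm_has_sup A :
  has_sup [set vnorm (A *m v) | v in [set v : 'cV[C]_n | vnorm v <= 1]].
Proof.
split; first by exists (vnorm (A *m 0)), 0 => //=; rewrite vnorm0.
have [K K0 HK] := vnorm_mulmx_bounded A.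
by exists K => _ [v /= v1 <-]; rewrite (le_trans (HK v))// ler_piMr.
Qed.

Lemma opnorm_ge0 A : 0 <= opnorm A.
Proof.
have [_ ub] := opnorm_has_sup A; apply: ub_le_sup => //.
by exists 0; rewrite /= ?vnorm0// mulmx0 vnorm0.
Qed.

Lemma vnorm_mulmx A v : vnorm (A *m v) <= opnorm A * vnorm v.
Proof.
have [v0|v0] := eqVneq (vnorm v) 0.
  by rewrite v0 mulr0 (vnorm_eq0 v0) mulmx0 vnorm0.
have vp : 0 < vnorm v by rewrite lt_def v0 vnorm_ge0.
have [_ ub] := opnorm_has_sup A.
have : vnorm (A *m (cR (vnorm v)^-1 *: v)) <= opnorm A.
  apply: ub_le_sup => //; exists (cR (vnorm v)^-1 *: v) => //=.
  by rewrite vnormZR ger0_norm ?invr_ge0 ?vnorm_ge0// mulVf.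
rewrite -scalemxAr vnormZR ger0_norm ?invr_ge0 ?vnorm_ge0//.
by rewrite mulrC ler_pdivrMr.
Qed.

End Opnorm.
End ComplexEuclidean.

(** * Calculus of real and complex matrix-valued functions on a segment *)

Section Calculus.
Variable R : realType.
Local Notation C := R[i].
Local Notation Re := (@complex.Re R).
Local Notation Im := (@complex.Im R).

(** Exactly what the mean value theorem consumes: continuity up to the ends, a derivative only
    inside. The evolution and the primitives of [f1], [f2] are available in this form. *)
Definition rdiff (a b : R) (f df : R -> R) : Prop :=
  {within `[a, b], continuous f} /\
  forall t, t \in `]a, b[ -> is_derive t 1 f (df t).

Section Rdiff.
Variables a b : R.

Lemma eq_rdiff f g df dg : f =1 g -> {in `]a, b[, df =1 dg} ->
  rdiff a b f df -> rdiff a b g dg.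
Proof.
by move=> /funext -> e [cf Df]; split => // t tab; rewrite -e//; exact: Df.
Qed.

Lemma rdiff_cst x : rdiff a b (fun=> x) (fun=> 0).
Proof.
split; first by move=> t; exact: cvg_cst.
by move=> t _; exact: is_derive_cst.
Qed.

Lemma rdiff_id : rdiff a b id (fun=> 1).
Proof.
split; first by apply: continuous_subspaceT => t; exact: cvg_id.
by move=> t _; exact: is_derive_id.
Qed.

Lemma rdiffD f g df dg : rdiff a b f df -> rdiff a b g dg ->
  rdiff a b (fun t => f t + g t) (fun t => df t + dg t).
Proof.
move=> [cf Df] [cg Dg]; split => [t|t tab]; first exact: cvgD (cf t) (cg t).
exact: is_deriveD (Df t tab) (Dg t tab).
Qed.

Lemma rdiffN f df : rdiff a b f df -> rdiff a b (fun t => - f t) (fun t => - df t).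
Proof.
move=> [cf Df]; split => [t|t tab]; first exact: cvgN (cf t).
exact: is_deriveN (Df t tab).
Qed.

Lemma rdiffB f g df dg : rdiff a b f df -> rdiff a b g dg ->
  rdiff a b (fun t => f t - g t) (fun t => df t - dg t).
Proof. by move=> hf hg; apply: rdiffD hf (rdiffN hg). Qed.

Lemma rdiffM f g df dg : rdiff a b f df -> rdiff a b g dg ->
  rdiff a b (fun t => f t * g t) (fun t => df t * g t + f t * dg t).
Proof.
move=> [cf Df] [cg Dg]; split => [t|t tab]; first exact: cvgM (cf t) (cg t).
have := is_deriveM (Df t tab) (Dg t tab).
by rewrite /GRing.scale /= addrC [g t * _]mulrC.
Qed.

Lemma rdiff_sum (I : Type) (r : seq I) (F dF : I -> R -> R) :
  (forall i, rdiff a b (F i) (dF i)) ->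
  rdiff a b (fun t => \sum_(i <- r) F i t) (fun t => \sum_(i <- r) dF i t).
Proof.
move=> h; elim: r => [|i r IH].
  by apply: eq_rdiff (rdiff_cst 0) => [t|t _]; rewrite big_nil.
by apply: eq_rdiff (rdiffD (h i) IH) => [t|t _]; rewrite big_cons.
Qed.

Lemma rdiff_subset c d f df : a <= c -> d <= b ->
  rdiff a b f df -> rdiff c d f df.
Proof.
move=> ac db [cf Df]; split.
  by apply: continuous_subspaceW cf; apply: subset_itvScc; rewrite bnd_simp.
move=> t /[!in_itv]/= /andP[ct td]; apply: Df.
by rewrite in_itv/= (le_lt_trans ac ct) (lt_le_trans td db).
Qed.

Lemma rdiff_comp (g dg f df : R -> R) : (forall x : R, is_derive x 1 g (dg x)) ->
  rdiff a b f df -> rdiff a b (fun t => g (f t)) (fun t => df t * dg (f t)).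
Proof.
move=> Dg [cf Df]; split => [t|t tab].
  have gc : {for f t, continuous g}.
    have [D _] := Dg (f t).
    by apply: differentiable_continuous; apply/derivable1_diffP.
  exact: (cvg_comp _ _ (cf t) gc).
have := is_derive1_comp (Dg (f t)) (Df t tab).
by rewrite mulrC.
Qed.

Lemma rdiff_mvt f df (M : R) : a <= b -> 0 <= M -> rdiff a b f df ->
  (forall t, t \in `]a, b[ -> df t <= M) -> f b - f a <= M * (b - a).
Proof.
rewrite le_eqVlt => /predU1P[->|ab] M0; first by rewrite !subrr mulr0.
move=> [cf Df] hM; have [c cab ->] := MVT ab Df cf.
by rewrite ler_wpM2r ?hM// subr_ge0 ltW.
Qed.

End Rdiff.

Lemma rdiff_lipschitz (a b : R) f df (M : R) : 0 <= M -> rdiff a b f df ->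
  (forall t, t \in `]a, b[ -> `|df t| <= M) ->
  {in `[a, b] &, forall x y, `|f y - f x| <= M * `|y - x|}.
Proof.
move=> M0 hf hM.
have key x y : a <= x -> x <= y -> y <= b -> `|f y - f x| <= M * `|y - x|.
  move=> ax xy yb; rewrite (@ger0_norm _ (y - x)) ?subr_ge0//.
  have h := rdiff_subset ax yb hf.
  have hM' t : t \in `]x, y[ -> `|df t| <= M.
    move=> /[!in_itv]/= /andP[xt ty]; apply: hM.
    by rewrite in_itv/= (le_lt_trans ax xt) (lt_le_trans ty yb).
  rewrite ler_norml; apply/andP; split.
    have := rdiff_mvt xy M0 (rdiffN h) (fun t tt => le_trans (ler_norm _)
      (eq_ind_r (fun z => z <= M) (hM' t tt) (normrN _))).
    lra.
  by apply: (rdiff_mvt xy M0 h) => t tt; rewrite (le_trans (ler_norm _))// hM'.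
move=> x y /[!in_itv]/= /andP[ax xb] /andP[ay yb].
have [xy|/ltW yx] := leP x y; first exact: key.
by rewrite distrC [`|y - x|]distrC; apply: key.
Qed.

(** Entrywise on real and imaginary parts, so that all rules reduce to those for real functions. *)
Definition mdiff (a b : R) p q (Y dY : R -> 'M[C]_(p, q)) : Prop :=
  forall i j, rdiff a b (fun t => Re (Y t i j)) (fun t => Re (dY t i j)) /\
              rdiff a b (fun t => Im (Y t i j)) (fun t => Im (dY t i j)).

Section Mdiff.
Variables a b : R.

Lemma eq_mdiff p q (Y Z dY dZ : R -> 'M[C]_(p, q)) :
  Y =1 Z -> {in `]a, b[, dY =1 dZ} -> mdiff a b Y dY -> mdiff a b Z dZ.
Proof.
move=> e de h i j; have [h1 h2] := h i j.
split; [apply: eq_rdiff h1|apply: eq_rdiff h2] => t; rewrite ?e// => tt;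
  by rewrite de.
Qed.

Lemma mdiff_cst p q (A : 'M[C]_(p, q)) : mdiff a b (fun=> A) (fun=> 0).
Proof.
by move=> i j; split; [apply: eq_rdiff (rdiff_cst _ _ (Re (A i j)))
  |apply: eq_rdiff (rdiff_cst _ _ (Im (A i j)))] => // t _; rewrite mxE.
Qed.

Lemma mdiffD p q (Y Z dY dZ : R -> 'M[C]_(p, q)) :
  mdiff a b Y dY -> mdiff a b Z dZ ->
  mdiff a b (fun t => Y t + Z t) (fun t => dY t + dZ t).
Proof.
move=> hY hZ i j; have [h1 h2] := hY i j; have [h3 h4] := hZ i j.
by split; [apply: eq_rdiff (rdiffD h1 h3)|apply: eq_rdiff (rdiffD h2 h4)]
  => t *; rewrite !mxE ?ReCD ?ImCD.
Qed.

Lemma mdiffN p q (Y dY : R -> 'M[C]_(p, q)) :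
  mdiff a b Y dY -> mdiff a b (fun t => - Y t) (fun t => - dY t).
Proof.
move=> hY i j; have [h1 h2] := hY i j.
by split; [apply: eq_rdiff (rdiffN h1)|apply: eq_rdiff (rdiffN h2)]
  => t *; rewrite !mxE ?ReCN ?ImCN.
Qed.

Lemma mdiffB p q (Y Z dY dZ : R -> 'M[C]_(p, q)) :
  mdiff a b Y dY -> mdiff a b Z dZ ->
  mdiff a b (fun t => Y t - Z t) (fun t => dY t - dZ t).
Proof. by move=> hY hZ; apply: mdiffD hY (mdiffN hZ). Qed.

Lemma mdiffM p q r (Y dY : R -> 'M[C]_(p, q)) (Z dZ : R -> 'M[C]_(q, r)) :
  mdiff a b Y dY -> mdiff a b Z dZ ->
  mdiff a b (fun t => Y t *m Z t) (fun t => dY t *m Z t + Y t *m dZ t).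
Proof.
move=> hY hZ i j; split.
- apply: eq_rdiff (rdiff_sum (index_enum 'I_q) (fun k =>
    rdiffB (rdiffM (hY i k).1 (hZ k j).1) (rdiffM (hY i k).2 (hZ k j).2))).
  + by move=> t; rewrite mxE Re_sum; apply: eq_bigr => k _; rewrite ReCM.
  + move=> t _; rewrite !mxE -big_split Re_sum; apply: eq_bigr => k _ /=.
    by rewrite ReCD !ReCM; ring.
- apply: eq_rdiff (rdiff_sum (index_enum 'I_q) (fun k =>
    rdiffD (rdiffM (hY i k).1 (hZ k j).2) (rdiffM (hY i k).2 (hZ k j).1))).
  + by move=> t; rewrite mxE Im_sum; apply: eq_bigr => k _; rewrite ImCM.
  + move=> t _; rewrite !mxE -big_split Im_sum; apply: eq_bigr => k _ /=.
    by rewrite ImCD !ImCM; ring.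
Qed.

Lemma mdiffMl p q r (A : 'M[C]_(p, q)) (Z dZ : R -> 'M[C]_(q, r)) :
  mdiff a b Z dZ -> mdiff a b (fun t => A *m Z t) (fun t => A *m dZ t).
Proof.
by move=> hZ; apply: eq_mdiff (mdiffM (mdiff_cst A) hZ) => [//|t _];
  rewrite mul0mx add0r.
Qed.

Lemma mdiffMr p q r (A : 'M[C]_(q, r)) (Y dY : R -> 'M[C]_(p, q)) :
  mdiff a b Y dY -> mdiff a b (fun t => Y t *m A) (fun t => dY t *m A).
Proof.
by move=> hY; apply: eq_mdiff (mdiffM hY (mdiff_cst A)) => [//|t _];
  rewrite mulmx0 addr0.
Qed.

Lemma mdiffZR p q (f df : R -> R) (Y dY : R -> 'M[C]_(p, q)) :
  rdiff a b f df -> mdiff a b Y dY ->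
  mdiff a b (fun t => cR (f t) *: Y t) (fun t => cR (df t) *: Y t + cR (f t) *: dY t).
Proof.
move=> hf hY i j; have [h1 h2] := hY i j.
by split; [apply: eq_rdiff (rdiffM hf h1)|apply: eq_rdiff (rdiffM hf h2)]
  => t *; rewrite !mxE ?ReCD ?ImCD ?ReCM ?ImCM /=; ring.
Qed.

Lemma mdiff_adj p q (Y dY : R -> 'M[C]_(p, q)) :
  mdiff a b Y dY -> mdiff a b (fun t => mx_adj (Y t)) (fun t => mx_adj (dY t)).
Proof.
move=> hY i j; have [h1 h2] := hY j i.
split; [apply: eq_rdiff h1|apply: eq_rdiff (rdiffN h2)] => t *; rewrite !mxE.
- by case: (Y t j i).
- by case: (dY t j i).
- by case: (Y t j i).
- by case: (dY t j i).
Qed.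

Lemma mdiff_subset c d p q (Y dY : R -> 'M[C]_(p, q)) : a <= c -> d <= b ->
  mdiff a b Y dY -> mdiff c d Y dY.
Proof.
by move=> ac db hY i j; have [h1 h2] := hY i j; split; apply: rdiff_subset ac db _.
Qed.

Lemma rdiff_rdot n (x y dx dy : R -> 'cV[C]_n) :
  mdiff a b x dx -> mdiff a b y dy ->
  rdiff a b (fun t => rdot (x t) (y t))
            (fun t => rdot (dx t) (y t) + rdot (x t) (dy t)).
Proof.
move=> hx hy; have [h _] := mdiffM (mdiff_adj hx) hy 0 0.
by apply: eq_rdiff h => // t _; rewrite mxE ReCD.
Qed.

(* Pairing with the increment reduces the vector-valued mean value inequality
   to the real one. *)
Lemma mdiff_mvt n (y dy : R -> 'cV[C]_n) (M : R) : a <= b -> 0 <= M ->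
  mdiff a b y dy -> (forall t, t \in `]a, b[ -> vnorm (dy t) <= M) ->
  vnorm (y b - y a) <= M * (b - a).
Proof.
move=> ab M0 hy hM; set w := y b - y a.
have [w0|w0] := eqVneq (vnorm w) 0.
  by rewrite w0 mulr_ge0// subr_ge0.
have wp : 0 < vnorm w by rewrite lt_def w0 vnorm_ge0.
have hr := rdiff_rdot (mdiff_cst w) hy.
have := rdiff_mvt (M := vnorm w * M) ab _ hr.
rewrite -rdotBr -/w -vnorm_sqr expr2 -mulrA ler_pM2l//; apply.
  by rewrite mulr_ge0// vnorm_ge0.
move=> t tab; rewrite rdotC /rdot mulmx0 mxE add0r -/(rdot w (dy t)).
by rewrite (le_trans (rdot_le _ _))// ler_pM2l// hM.
Qed.

(** The outer function must be differentiable on every segment, because the values of [f] are not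
    confined to a given one. *)
Lemma mdiff_comp p q (Y dY : R -> 'M[C]_(p, q)) (f df : R -> R) :
  (forall c d, mdiff c d Y dY) -> rdiff a b f df ->
  mdiff a b (fun t => Y (f t)) (fun t => cR (df t) *: dY (f t)).
Proof.
move=> hY hf i j.
have D (x : R) : x \in `](x - 1), (x + 1)[ by rewrite in_itv/=; lra.
split.
- have h x := (hY (x - 1) (x + 1) i j).1.2 x (D x).
  apply: eq_rdiff (rdiff_comp h hf) => // t _.
  by rewrite !mxE ReCM /= mul0r subr0.
- have h x := (hY (x - 1) (x + 1) i j).2.2 x (D x).
  apply: eq_rdiff (rdiff_comp h hf) => // t _.
  by rewrite !mxE ImCM /= mul0r addr0.
Qed.

End Mdiff.

(** The derivative of the squared norm is twice the inner product of [y] with [-iA y], which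
    vanishes for Hermitian [A]. *)
Lemma vnorm_conserved (a b : R) n (A : R -> 'M[C]_n) (y : R -> 'cV[C]_n) :
  a <= b -> (forall t, t \in `]a, b[ -> is_hermitian (A t)) ->
  mdiff a b y (fun t => - cI R *: (A t *m y t)) -> vnorm (y b) = vnorm (y a).
Proof.
move=> ab hA hy; rewrite !vnormE; congr Num.sqrt; apply/eqP.
rewrite -subr_eq0 -normr_le0.
have h := rdiff_rdot hy hy.
have abb : b \in `[a, b] by rewrite in_itv/= ab lexx.
have aba : a \in `[a, b] by rewrite in_itv/= ab lexx.
have := rdiff_lipschitz (lexx 0) h _ aba abb; rewrite mul0r; apply.
by move=> t /hA hAt; rewrite [X in X + _]rdotC !rdot_antiherm// addr0 normr0.
Qed.

End Calculus.

(** * Differentiability of the matrix exponential through its entrywise power series *)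

Section MatrixExponential.
Variable R : realType.
Local Notation C := R[i].
Local Notation Re := (@complex.Re R).
Local Notation Im := (@complex.Im R).

Section ExponentialGeneratingFunction.
Variables (w : nat -> R) (K M : R).
Hypothesis wKM : forall k, `|w k| <= K * M ^+ k.

(** Comparison with [K] times the exponential series at [|M| |x|]. *)
Lemma egf_bounded_cvg (x : R) : cvgn (pseries (fun k => w k / k`!%:R) x).
Proof.
have K0 : 0 <= K by have := le_trans (normr_ge0 _) (wKM 0); rewrite expr0 mulr1.
apply: normed_cvg.
apply: (@series_le_cvg _ _ (K *: exp_coeff (`|M| * `|x|))).
- by move=> n; exact: normr_ge0.
- by move=> n; rewrite /exp_coeff /= mulr_ge0// divr_ge0// exprn_ge0// mulr_ge0.
- move=> n; rewrite /= normrM normrM normfV normr_nat normrX /exp_coeff.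
  rewrite [leRHS](_ : _ = K * `|M| ^+ n / n`!%:R * `|x| ^+ n); last first.
    by rewrite /GRing.scale /= /GRing.scale /= exprMn; ring.
  rewrite ler_wpM2r ?exprn_ge0// ler_wpM2r ?invr_ge0//.
  by rewrite (le_trans (wKM n))// ler_wpM2l// -normrX ler_norm.
- by apply: is_cvg_seriesZ; exact: is_cvg_series_exp_coeff.
Qed.

End ExponentialGeneratingFunction.

Lemma pseries_diffs_egf (w : nat -> R) :
  pseries_diffs (fun k => w k / k`!%:R) = fun k => w k.+1 / k`!%:R.
Proof.
apply/funext => k; rewrite /pseries_diffs factS natrM invfM.
by rewrite mulrCA [X in _ * X]mulrA divff ?mul1r// pnatr_eq0.
Qed.

(** Termwise differentiation asks for convergence of the series and of its first two derivatives at
    a point beyond [|x|], here [|x| + 1]. Each derivative shifts [w] by one, which preserves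
    geometric growth at the cost of a factor [M]. *)
Lemma egf_bounded_derive (w : nat -> R) (K M x : R) :
  (forall k, `|w k| <= K * M ^+ k) ->
  is_derive x 1 (fun y => limn (pseries (fun k => w k / k`!%:R) y))
    (limn (pseries (fun k => w k.+1 / k`!%:R) x)).
Proof.
move=> wKM.
have w1 k : `|w k.+1| <= (K * M) * M ^+ k by rewrite -mulrA -exprS.
have w2 k : `|w k.+2| <= (K * M * M) * M ^+ k by rewrite -mulrA -exprS.
rewrite -pseries_diffs_egf.
apply: (@pseries_snd_diffs _ _ (`|x| + 1)).
- exact: egf_bounded_cvg wKM _.
- by rewrite pseries_diffs_egf; exact: egf_bounded_cvg w1 _.
- rewrite pseries_diffs_egf (pseries_diffs_egf (fun k => w k.+1)).
  exact: egf_bounded_cvg w2 _.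
- by rewrite [ltRHS]ger0_norm ?ltrDl// addr_ge0.
Qed.

Lemma cabs2_le_vnorm n (v : 'cV[C]_n) i : cabs2 (v i 0) <= vnorm v ^+ 2.
Proof.
rewrite vnorm_sqr rdotvv (bigD1 i)//= lerDl sumr_ge0// => k _.
by rewrite addr_ge0// sqr_ge0.
Qed.

Lemma normRe_le_vnorm n (v : 'cV[C]_n) i : `|Re (v i 0)| <= vnorm v.
Proof.
rewrite -(@ler_pXn2r _ 2)// ?nnegrE ?vnorm_ge0// real_normK ?num_real//.
by rewrite (le_trans _ (cabs2_le_vnorm v i))// lerDl sqr_ge0.
Qed.

Lemma normIm_le_vnorm n (v : 'cV[C]_n) i : `|Im (v i 0)| <= vnorm v.
Proof.
rewrite -(@ler_pXn2r _ 2)// ?nnegrE ?vnorm_ge0// real_normK ?num_real//.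
by rewrite (le_trans _ (cabs2_le_vnorm v i))// lerDr sqr_ge0.
Qed.

Lemma cvgn_sum (I : Type) (r : seq I) (u : I -> nat -> R) (l : I -> R) :
  (forall i, u i @ \oo --> l i) ->
  (fun N => \sum_(i <- r) u i N) @ \oo --> \sum_(i <- r) l i.
Proof.
move=> h; elim: r => [|i r IH].
  by rewrite big_nil; under eq_fun do rewrite big_nil; exact: cvg_cst.
by rewrite big_cons; under eq_fun do rewrite big_cons; exact: cvgD.
Qed.

Section Expmi.
Variable n : nat.
Implicit Types A B : 'M[C]_n.

Lemma mxpowS A k : mxpow A k.+1 = A *m mxpow A k. Proof. by []. Qed.

Lemma mxpowZR (x : R) A k : mxpow (cR x *: A) k = cR (x ^+ k) *: mxpow A k.
Proof.
elim: k => [|k IH]; first by rewrite expr0 /mxpow /= scale1r.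
by rewrite !mxpowS IH -scalemxAl -scalemxAr scalerA -cRM exprS.
Qed.

Lemma vnorm_mxpow A k (v : 'cV[C]_n) :
  vnorm (mxpow A k *m v) <= vnorm v * opnorm A ^+ k.
Proof.
elim: k => [|k IH]; first by rewrite expr0 mulr1 /mxpow /= mul1mx.
rewrite mxpowS -mulmxA (le_trans (vnorm_mulmx _ _))//.
by rewrite exprS mulrCA ler_wpM2l// opnorm_ge0.
Qed.

Lemma mxpow_bound A i j : exists K : R, forall k,
  `|Re (mxpow A k i j)| <= K * opnorm A ^+ k /\
  `|Im (mxpow A k i j)| <= K * opnorm A ^+ k.
Proof.
pose e : 'cV[C]_n := delta_mx j 0; exists (vnorm e) => k.
have E : mxpow A k i j = (mxpow A k *m e) i 0.
  by rewrite -colE mxE.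
split; rewrite E (le_trans _ (vnorm_mxpow A k e))//.
- exact: normRe_le_vnorm.
- exact: normIm_le_vnorm.
Qed.

(** With the scalar pulled out of the powers, each entry is a power series in [x] whose coefficients
    do not depend on [x], ready for termwise differentiation. *)
Lemma expmiE (x : R) A i j : expmi x A i j =
  Complex (limn (pseries (fun k => Re (mxpow (- cI R *: A) k i j) / k`!%:R) x))
          (limn (pseries (fun k => Im (mxpow (- cI R *: A) k i j) / k`!%:R) x)).
Proof.
rewrite /expmi mxE.
have -> : - (cI R * cR x) *: A = cR x *: (- cI R *: A).
  by rewrite scalerA mulrN mulrC.
congr Complex; congr (limn _); apply/funext => N;
  rewrite /pseries /series /= big_mkord; apply: eq_bigr => k _;
  by rewrite mxpowZR mxE ?ReCM ?ImCM /=; ring.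
Qed.

Lemma cvg_Re_expmi (x : R) A i j :
  pseries (fun k => Re (mxpow (- cI R *: A) k i j) / k`!%:R) x @ \oo -->
  Re (expmi x A i j).
Proof.
have [K hK] := mxpow_bound (- cI R *: A) i j.
by rewrite expmiE /=; exact: egf_bounded_cvg (fun k => (hK k).1) x.
Qed.

Lemma cvg_Im_expmi (x : R) A i j :
  pseries (fun k => Im (mxpow (- cI R *: A) k i j) / k`!%:R) x @ \oo -->
  Im (expmi x A i j).
Proof.
have [K hK] := mxpow_bound (- cI R *: A) i j.
by rewrite expmiE /=; exact: egf_bounded_cvg (fun k => (hK k).2) x.
Qed.

(** Termwise differentiation shifts [k] to [k + 1], which is left multiplication of the powers by
    [B = -iA]. That product is a finite sum along a row of [B], so the limit passes inside it. *)
Lemma mdiff_expmi (a b : R) A :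
  mdiff a b (fun t => expmi t A) (fun t => - cI R *: (A *m expmi t A)).
Proof.
move=> i j; set B := - cI R *: A.
have [K hK] := mxpow_bound B i j.
have Bc (x : R) : - cI R *: (A *m expmi x A) = B *m expmi x A.
  by rewrite scalemxAl.
have DRe (x : R) : is_derive x 1 (fun t => Re (expmi t A i j))
    (Re ((- cI R *: (A *m expmi x A)) i j)).
  have := egf_bounded_derive x (fun k => (hK k).1).
  rewrite (_ : (fun y => limn _) = fun t => Re (expmi t A i j)); last first.
    by apply/funext => t; rewrite expmiE.
  rewrite (_ : limn _ = Re ((- cI R *: (A *m expmi x A)) i j))//.
  apply: cvg_lim => //; rewrite Bc mxE Re_sum.
  pose u l := pseries (fun k => Re (mxpow B k l j) / k`!%:R) x.
  pose v l := pseries (fun k => Im (mxpow B k l j) / k`!%:R) x.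
  rewrite (_ : pseries _ x =
    fun N => \sum_l (Re (B i l) * u l N - Im (B i l) * v l N)); last first.
    apply/funext => N; rewrite /u /v /pseries /series /=.
    under [RHS]eq_bigr do rewrite !mulr_sumr -sumrB.
    rewrite exchange_big /=; apply: eq_bigr => k _.
    rewrite mxE Re_sum !mulr_suml; apply: eq_bigr => l _.
    by rewrite ReCM; ring.
  under eq_bigr do rewrite ReCM.
  apply: cvgn_sum => l; apply: cvgB; apply: cvgM (cvg_cst _) _;
    [exact: cvg_Re_expmi|exact: cvg_Im_expmi].
have DIm (x : R) : is_derive x 1 (fun t => Im (expmi t A i j))
    (Im ((- cI R *: (A *m expmi x A)) i j)).
  have := egf_bounded_derive x (fun k => (hK k).2).
  rewrite (_ : (fun y => limn _) = fun t => Im (expmi t A i j)); last first.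
    by apply/funext => t; rewrite expmiE.
  rewrite (_ : limn _ = Im ((- cI R *: (A *m expmi x A)) i j))//.
  apply: cvg_lim => //; rewrite Bc mxE Im_sum.
  pose u l := pseries (fun k => Re (mxpow B k l j) / k`!%:R) x.
  pose v l := pseries (fun k => Im (mxpow B k l j) / k`!%:R) x.
  rewrite (_ : pseries _ x =
    fun N => \sum_l (Re (B i l) * v l N + Im (B i l) * u l N)); last first.
    apply/funext => N; rewrite /u /v /pseries /series /=.
    under [RHS]eq_bigr do rewrite !mulr_sumr -big_split.
    rewrite exchange_big /=; apply: eq_bigr => k _.
    rewrite mxE Im_sum !mulr_suml; apply: eq_bigr => l _.
    by rewrite ImCM; ring.
  under eq_bigr do rewrite ImCM.
  apply: cvgn_sum => l; apply: cvgD; apply: cvgM (cvg_cst _) _;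
    [exact: cvg_Im_expmi|exact: cvg_Re_expmi].
by split; [apply: eq_rdiff (rdiff_comp DRe (rdiff_id a b))
  |apply: eq_rdiff (rdiff_comp DIm (rdiff_id a b))] => // t _; rewrite mul1r.
Qed.

Lemma expmi0 A : expmi 0 A = 1%:M.
Proof.
(* Because [0 ^+ 0 = 1], the partial sums are constant from [N = 1] on; only the empty sum at
   [N = 0] differs. *)
have L (u : nat -> R) : limn (pseries (fun k => u k / k`!%:R) 0) = u 0%N.
  apply: lim_near_cst => //; exists 1%N => // -[//|N] _.
  rewrite /pseries /series /= big_mkord big_ord_recl /= big1; last first.
    by move=> k _; rewrite expr0n /= mulr0.
  by rewrite fact0 expr0 divr1 mulr1 addr0.
apply/matrixP => i j; rewrite expmiE (L (fun k => Re (mxpow _ k i j))).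
by rewrite (L (fun k => Im (mxpow _ k i j))); apply: complex_ext.
Qed.

End Expmi.
End MatrixExponential.

(** * Unitary groups generated by Hermitian matrices *)

Section HermitianExponential.
Variable R : realType.
Local Notation C := R[i].

Lemma mulmx_ext m n (A B : 'M[C]_(m, n)) :
  (forall v : 'cV[C]_n, A *m v = B *m v) -> A = B.
Proof.
move=> h; apply/matrixP => i j.
by have /matrixP/(_ i 0) := h (delta_mx j 0); rewrite -!colE !mxE.
Qed.

(** Allows [x] of either sign, since the angles of the exponentials take the signs of [f1] and
    [f2]. *)
Lemma mdiff_lipschitz0 n (y dy : R -> 'cV[C]_n) (M x : R) : 0 <= M ->
  (forall c d, mdiff c d y dy) ->
  (forall t, `|t| <= `|x| -> vnorm (dy t) <= M) ->
  vnorm (y x - y 0) <= M * `|x|.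
Proof.
move=> M0 hy hM; have [x0|/ltW x0] := leP 0 x.
  rewrite ger0_norm// -[in leRHS](subr0 x); apply: mdiff_mvt (hy _ _) _ => //.
  move=> t /[!in_itv]/= /andP[t0 tx]; apply: hM.
  by rewrite !ger0_norm// ltW.
rewrite ler0_norm// -[in leRHS](sub0r x) vnorm_distC.
apply: mdiff_mvt (hy _ _) _ => //.
move=> t /[!in_itv]/= /andP[t0 tx]; apply: hM.
by rewrite !ler0_norm// ?lerN2 ltW.
Qed.

Lemma vnorm_conserved0 n (A : 'M[C]_n) (y : R -> 'cV[C]_n) (x : R) :
  is_hermitian A -> (forall c d, mdiff c d y (fun t => - cI R *: (A *m y t))) ->
  vnorm (y x) = vnorm (y 0).
Proof.
move=> hA hy; have [x0|/ltW x0] := leP 0 x.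
  exact: (@vnorm_conserved _ 0 x _ (fun=> A)).
by apply/esym; exact: (@vnorm_conserved _ x 0 _ (fun=> A)).
Qed.

(* The exponential [t |-> exp(-i t A)] is used only through this
   characterization. *)
Definition propagator n (A : 'M[C]_n) (E : R -> 'M[C]_n) : Prop :=
  E 0 = 1%:M /\ forall c d, mdiff c d E (fun t => - cI R *: (A *m E t)).

Lemma expmi_propagator n (A : 'M[C]_n) : propagator A (fun t => expmi t A).
Proof. by split=> [|c d]; [exact: expmi0|exact: mdiff_expmi]. Qed.

Section Propagator.
Variables (n : nat) (A : 'M[C]_n) (E : R -> 'M[C]_n).
Hypotheses (hA : is_hermitian A) (hE : propagator A E).
Implicit Types (v w u : 'cV[C]_n) (t : R).

Lemma mdiff_prop_vec c d v :
  mdiff c d (fun t => E t *m v) (fun t => - cI R *: (A *m (E t *m v))).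
Proof.
by apply: eq_mdiff (mdiffMr v (hE.2 c d)) => [//|t _];
  rewrite -scalemxAl mulmxA.
Qed.

Lemma prop_isometry t v : vnorm (E t *m v) = vnorm v.
Proof.
rewrite (vnorm_conserved0 t hA (fun c d => mdiff_prop_vec c d v)).
by rewrite hE.1 mul1mx.
Qed.

(* [A E(t) v - E(t) A v] solves the same norm-preserving equation and vanishes
   at [t = 0]. *)
Lemma prop_comm t : E t *m A = A *m E t.
Proof.
apply: mulmx_ext => v; apply/esym/eqP; rewrite -subr_eq0; apply/eqP/vnorm_eq0.
pose y s := A *m E s *m v - E s *m A *m v.
have hy c d : mdiff c d y (fun s => - cI R *: (A *m y s)).
  apply: eq_mdiff (mdiffB (mdiffMl A (mdiff_prop_vec c d v))
    (mdiff_prop_vec c d (A *m v))) => s *; first by rewrite /y !mulmxA.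
  by rewrite -scalemxAr -scalerBr /y mulmxBr !mulmxA.
rewrite -/(y t) (vnorm_conserved0 t hA hy) /y hE.1.
by rewrite mulmx1 mul1mx subrr vnorm0.
Qed.

Lemma prop_commV t v : A *m (E t *m v) = E t *m (A *m v).
Proof. by rewrite !mulmxA prop_comm. Qed.

Lemma mdiff_prop_comp (a b : R) (f df : R -> R) : rdiff a b f df ->
  mdiff a b (fun t => E (f t)) (fun t => - cI R *: (cR (df t) *: (A *m E (f t)))).
Proof.
move=> hf; apply: eq_mdiff (mdiff_comp (fun c d => hE.2 c d) hf) => [//|t _].
by rewrite !scalerA mulrC.
Qed.

Lemma mdiff_propN (a b : R) (f df : R -> R) : rdiff a b f df ->
  mdiff a b (fun t => E (- f t)) (fun t => cI R *: (cR (df t) *: (A *m E (- f t)))).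
Proof.
move=> hf; apply: eq_mdiff (mdiff_prop_comp (rdiffN hf)) => [//|t _].
by rewrite cRN !scaleNr scalerN opprK.
Qed.

(** Since [E] commutes with [A], the derivative of [E(-s) E(s) v] vanishes. *)
Lemma propK t : E (- t) *m E t = 1%:M.
Proof.
apply: mulmx_ext => v; rewrite mul1mx -mulmxA.
apply/eqP; rewrite -subr_eq0; apply/eqP/vnorm_eq0/le_anti.
rewrite vnorm_ge0 andbT -(mul0r `|t|).
pose y s := E (- s) *m (E s *m v).
have -> : E (- t) *m (E t *m v) - v = y t - y 0.
  by rewrite /y oppr0 hE.1 !mul1mx.
apply: (@mdiff_lipschitz0 _ y (fun=> 0)) => // [c d|s _]; last by rewrite vnorm0.
apply: eq_mdiff (mdiffM (mdiff_propN (rdiff_id c d)) (mdiff_prop_vec c d v)) => [//|s _].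
rewrite cR1 scale1r -scalemxAl -scalemxAr -prop_comm -mulmxA.
by rewrite scaleNr subrr.
Qed.

Lemma propKV t v : E (- t) *m (E t *m v) = v.
Proof. by rewrite mulmxA propK mul1mx. Qed.

Lemma propVK t v : E t *m (E (- t) *m v) = v.
Proof. by rewrite -{1}(opprK t) propKV. Qed.

(** Turns an error in the angle into an error in the state. The derivative has constant norm
    [|A v|], as [A] commutes with the isometries [E]. *)
Lemma prop_lipschitz s t v :
  vnorm (E s *m v - E t *m v) <= `|s - t| * vnorm (A *m v).
Proof.
pose y r := E (r + t) *m v.
have -> : E s *m v - E t *m v = y (s - t) - y 0.
  by rewrite /y add0r subrK.
rewrite mulrC; apply: (@mdiff_lipschitz0 _ y
    (fun r => - cI R *: (A *m (E (r + t) *m v)))).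
- exact: vnorm_ge0.
- move=> c d; apply: eq_mdiff (mdiffMr v (mdiff_prop_comp (rdiffD (rdiff_id c d)
    (rdiff_cst c d t)))) => [//|r _].
  by rewrite addr0 cR1 scale1r -scalemxAl mulmxA.
- by move=> r _; rewrite scaleNr vnormN vnormZI prop_commV prop_isometry.
Qed.

(** Heisenberg equation: differentiating a conjugated matrix conjugates its commutator with the
    generator. *)
Lemma prop_conj_mdiff c d (B : 'M[C]_n) u :
  mdiff c d (fun s => E (- s) *m (B *m (E s *m u)))
   (fun s => cI R *: (E (- s) *m (mxcomm A B *m (E s *m u)))).
Proof.
apply: eq_mdiff (mdiffM (mdiff_propN (rdiff_id c d))
  (mdiffMl B (mdiff_prop_vec c d u))) => [//|s _].
rewrite cR1 scale1r -prop_comm -scalemxAl -!scalemxAr scaleNr -scalerBr -mulmxA.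
by rewrite -mulmxBr /mxcomm mulmxBl -!mulmxA.
Qed.

(** The commutator is bounded only along the orbit of [u], so no norm of [A] enters the estimate. *)
Lemma prop_conj_lipschitz (B : 'M[C]_n) u (M t : R) : 0 <= M ->
  (forall s, vnorm (mxcomm A B *m (E s *m u)) <= M) ->
  vnorm (E (- t) *m (B *m (E t *m u)) - B *m u) <= M * `|t|.
Proof.
move=> M0 hM; pose y s := E (- s) *m (B *m (E s *m u)).
have -> : B *m u = y 0 by rewrite /y oppr0 hE.1 !mul1mx.
apply: (mdiff_lipschitz0 M0 (fun c d => prop_conj_mdiff c d B u)) => s _.
by rewrite vnormZI prop_isometry.
Qed.

(** The derivative of the remainder is the first-order conjugation error of the commutator, hence at
    most [M |t|] by the previous lemma; the mean value inequality supplies the second factor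
    [|t|]. *)
Lemma prop_conj_taylor2 (B : 'M[C]_n) u (M t : R) : 0 <= M ->
  (forall s, vnorm (mxcomm A (mxcomm A B) *m (E s *m u)) <= M) ->
  vnorm (E (- t) *m (B *m (E t *m u)) - B *m u
         - cR t *: (cI R *: (mxcomm A B *m u))) <= M * `|t| ^+ 2.
Proof.
move=> M0 hM; set K := mxcomm A B.
pose y s := E (- s) *m (B *m (E s *m u)) - cR s *: (cI R *: (K *m u)).
have -> : E (- t) *m (B *m (E t *m u)) - B *m u - cR t *: (cI R *: (K *m u)) =
    y t - y 0.
  rewrite /y oppr0 hE.1 !mul1mx cR0 scale0r subr0.
  by rewrite addrAC.
rewrite expr2 mulrA.
apply: (@mdiff_lipschitz0 _ y
  (fun s => cI R *: (E (- s) *m (K *m (E s *m u))) - cI R *: (K *m u))).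
- by rewrite mulr_ge0.
- move=> c d; apply: eq_mdiff (mdiffB (prop_conj_mdiff c d B u)
    (mdiffZR (rdiff_id c d) (mdiff_cst c d (cI R *: (K *m u))))) => [//|s _].
  by rewrite cR1 scale1r scaler0 addr0.
- move=> s st; rewrite -scalerBr vnormZI.
  by rewrite (le_trans (prop_conj_lipschitz s M0 hM))// ler_wpM2l.
Qed.

End Propagator.

(** Polarization: it transfers invariance from norms to inner products. *)
Lemma rdot_vnorm n (u v : 'cV[C]_n) :
  rdot u v = (vnorm (u + v) ^+ 2 - vnorm u ^+ 2 - vnorm v ^+ 2) / 2.
Proof. by rewrite !vnorm_sqr rdotDr !rdotDl (rdotC v u); field. Qed.

Section Factorized.
Variables (m n : nat) (A : 'M[C]_n) (E : R -> 'M[C]_n) (D : 'M[C]_(m, n)).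
Hypotheses (hA : is_hermitian A) (hE : propagator A E) (AD : A = mx_adj D *m D).

Lemma vnorm_factor_sqr v : vnorm (D *m v) ^+ 2 = rdot v (A *m v).
Proof. by rewrite vnorm_sqr rdot_adj AD mulmxA. Qed.

(** Cauchy-Schwarz applied to [|D v|^2 = <v, A v>]. This is the origin of the square root in the
    bound for the scheme (g,1). *)
Lemma vnorm_factor v : vnorm (D *m v) <= Num.sqrt (vnorm v * vnorm (A *m v)).
Proof.
rewrite -(ger0_norm (vnorm_ge0 _)) -sqrtr_sqr ler_wsqrtr//.
by rewrite vnorm_factor_sqr rdot_le.
Qed.

(** Nothing is known about commuting [D] with [E t], but the quadratic form [<v, A v>] is invariant
    under [E t]. *)
Lemma vnorm_factor_prop t v : vnorm (D *m (E t *m v)) = vnorm (D *m v).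
Proof.
apply/eqP; rewrite -(@eqrXn2 _ 2) ?vnorm_ge0// !vnorm_factor_sqr (prop_commV hA hE).
by rewrite !rdot_vnorm -mulmxDr !(prop_isometry hA hE).
Qed.

End Factorized.
End HermitianExponential.

(** * Error of a single step in the doubly rotated frame *)

Section LocalError.
Variable R : realType.
Local Notation C := R[i].
Variables (n m : nat) (H1 H2 : 'M[C]_n) (D1 : 'M[C]_(m, n)).
Variables (E1 E2 : R -> 'M[C]_n) (C1 C2 : R).
Hypotheses (hH1 : is_hermitian H1) (hH2 : is_hermitian H2).
Hypotheses (hE1 : propagator H1 E1) (hE2 : propagator H2 E2).
Hypothesis HD : H1 = mx_adj D1 *m D1.
Local Notation K := (mxcomm H1 H2).
Hypothesis hC1 : forall v, vnorm (K *m v) <= C1 * (vnorm (D1 *m v) + vnorm v).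
Hypothesis hC2 : forall v,
  vnorm (mxcomm H1 K *m v) <= C2 * (vnorm (H1 *m v) + vnorm v).
Hypotheses (C1_ge0 : 0 <= C1) (C2_ge0 : 0 <= C2).

Variables (x z : R) (f1 f2 F1 F2 : R -> R) (psi : R -> 'cV[C]_n) (p q al : R).
Hypothesis xz : x <= z.
Hypotheses (hF1 : rdiff x z F1 f1) (hF2 : rdiff x z F2 f2).
Hypothesis hpsi :
  mdiff x z psi (fun s => - cI R *: (Ham f1 f2 H1 H2 s *m psi s)).

Let th s := F1 s - F1 x - al.
Let be s := F2 s - F2 x.
Let u s := E1 (- th s) *m psi s.
Let y s := E2 (- be s) *m u s.

Lemma rdiff_th : rdiff x z th f1.
Proof.
apply: eq_rdiff (rdiffB (rdiffB hF1 (rdiff_cst x z (F1 x))) (rdiff_cst x z al)) => //.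
by move=> s _; rewrite !subr0.
Qed.

Lemma rdiff_be : rdiff x z be f2.
Proof.
apply: eq_rdiff (rdiffB hF2 (rdiff_cst x z (F2 x))) => //.
by move=> s _; rewrite !subr0.
Qed.

(** Interaction picture: rotating by [E1 (- th)] cancels the [f1 H1] term, since [th] has derivative
    [f1]. *)
Lemma mdiff_u :
  mdiff x z u (fun s => - cI R *: (cR (f2 s) *: (E1 (- th s) *m (H2 *m psi s)))).
Proof.
apply: eq_mdiff (mdiffM (mdiff_propN hE1 rdiff_th) hpsi) => [//|s _].
rewrite -(prop_comm hH1 hE1) /Ham mulmxDl -!scalemxAl -scalemxAr mulmxDr -!scalemxAr.
rewrite -mulmxA.
move: (E1 _ *m (H1 *m _)) (E1 _ *m (H2 *m _)) => v w.
by apply/matrixP => i j; rewrite !mxE; ring.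
Qed.

(** As [psi = E1(th) u], the bracket is the conjugate of [H2] by [E1(th)] minus [H2], applied to
    [u]. *)
Lemma mdiff_y : mdiff x z y (fun s => - cI R *: (cR (f2 s) *:
  (E2 (- be s) *m (E1 (- th s) *m (H2 *m psi s) - H2 *m u s)))).
Proof.
apply: eq_mdiff (mdiffM (mdiff_propN hE2 rdiff_be) mdiff_u) => [//|s _].
rewrite -(prop_comm hH2 hE2) -!scalemxAl -!scalemxAr mulmxBr -mulmxA.
move: (E2 _ *m (H2 *m _)) (E2 _ *m (E1 _ *m _)) => v w.
by apply/matrixP => i j; rewrite !mxE; ring.
Qed.

Lemma vnorm_u s : vnorm (u s) = vnorm (psi s).
Proof. exact: (prop_isometry hH1 hE1). Qed.

Lemma psi_u s : psi s = E1 (th s) *m u s.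
Proof. by rewrite /u (propVK hH1 hE1). Qed.

(** Telescoping from the scheme to [E1(th z) E2(be z) y(z) = psi z]: exchange [y x] for [y z], then
    the angle [q] for [be z], then [p] for [th z]. Only the last exchange costs a factor
    [|H1 psi|]. *)
Lemma step_error :
  vnorm (E1 p *m (E2 q *m (E1 al *m psi x)) - psi z) <=
  vnorm (y z - y x) + `|q - (F2 z - F2 x)| * (opnorm H2 * vnorm (psi z))
  + `|p + al - (F1 z - F1 x)| * vnorm (H1 *m psi z).
Proof.
(* At the left end [th = - al] and [be = 0], so [y] starts at the state after the first
   exponential. *)
have yx : E1 al *m psi x = y x.
  by rewrite /y /u /be /th !subrr sub0r opprK oppr0 hE2.1 mul1mx.
have uz : E2 (be z) *m y z = u z by rewrite /y (propVK hH2 hE2).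
rewrite yx {1}(psi_u z) -uz.
have -> : E1 p *m (E2 q *m y x) - E1 (th z) *m (E2 (be z) *m y z) =
  E1 p *m (E2 q *m (y x - y z)) + E1 p *m (E2 q *m y z - E2 (be z) *m y z)
  + (E1 p *m u z - E1 (th z) *m u z).
  by rewrite !mulmxBr -uz !subrKA.
rewrite (le_trans (vnormD _ _))// lerD//.
  rewrite (le_trans (vnormD _ _))// lerD//.
    by rewrite !(prop_isometry hH1 hE1) (prop_isometry hH2 hE2) vnorm_distC.
  rewrite (prop_isometry hH1 hE1) (le_trans (prop_lipschitz hH2 hE2 _ _ _))//.
  rewrite ler_wpM2l// (le_trans (vnorm_mulmx _ _))//.
  by rewrite /y (prop_isometry hH2 hE2) vnorm_u.
rewrite (le_trans (prop_lipschitz hH1 hE1 _ _ _))//.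
rewrite /u (prop_commV hH1 hE1) (prop_isometry hH1 hE1).
by rewrite /th (_ : p - _ = p + al - (F1 z - F1 x))//; ring.
Qed.

Lemma vnorm_D1_u s : vnorm (D1 *m u s) = vnorm (D1 *m psi s).
Proof. by rewrite /u (vnorm_factor_prop hH1 hE1 HD). Qed.

Lemma vnorm_K_prop t v :
  vnorm (K *m (E1 t *m v)) <= C1 * (vnorm (D1 *m v) + vnorm v).
Proof.
by rewrite (le_trans (hC1 _))// (vnorm_factor_prop hH1 hE1 HD)
  (prop_isometry hH1 hE1).
Qed.

Lemma vnorm_KK_prop t v :
  vnorm (mxcomm H1 K *m (E1 t *m v)) <= C2 * (vnorm (H1 *m v) + vnorm v).
Proof.
by rewrite (le_trans (hC2 _))// (prop_commV hH1 hE1) !(prop_isometry hH1 hE1).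
Qed.

(** Mean value inequality for [y], with the conjugation error bounded linearly in [th]. Both
    [|D1 u|] and [|u|] agree with those of [psi], so no [|H1 psi|] appears. *)
Lemma first_order_variation (P Th Q n0 : R) : 0 <= P -> 0 <= Th ->
  0 <= Q -> 0 <= n0 ->
  (forall s, s \in `]x, z[ -> [/\ `|f2 s| <= P, `|th s| <= Th,
    vnorm (D1 *m psi s) <= Q & vnorm (psi s) <= n0]) ->
  vnorm (y z - y x) <= P * (C1 * (Q + n0) * Th) * (z - x).
Proof.
move=> P0 Th0 Q0 n00 hb; apply: mdiff_mvt mdiff_y _ => //.
  by rewrite !mulr_ge0// addr_ge0.
move=> s /hb [f2P thT DQ pn].
rewrite scaleNr vnormN vnormZI vnormZR ler_pM ?vnorm_ge0//.
rewrite (prop_isometry hH2 hE2) {1}psi_u.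
apply: le_trans (prop_conj_lipschitz hH1 hE1 (th s)
  (M := C1 * (vnorm (D1 *m u s) + vnorm (u s))) _ _) _.
- by rewrite mulr_ge0// addr_ge0 ?vnorm_ge0.
- by move=> t; exact: vnorm_K_prop.
- rewrite vnorm_D1_u vnorm_u ler_pM// ?mulr_ge0// ?addr_ge0 ?vnorm_ge0//.
  by rewrite ler_wpM2l// lerD.
Qed.

(** Write [|D1 H2 v|^2 = <H2 v, H1 H2 v>] and [H1 H2 = K + H2 H1]; the factors [3] and [1] for these
    two terms add up to [4 = 2^2]. *)
Lemma vnorm_D1_H2 v (h2 N : R) : 0 <= h2 -> 0 <= N ->
  vnorm (H2 *m v) <= h2 * N -> vnorm (H2 *m (H1 *m v)) <= h2 * N ->
  vnorm (K *m v) <= 3 * (h2 * N) -> vnorm (D1 *m (H2 *m v)) <= 2 * (h2 * N).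
Proof.
move=> h0 N0 Hv HHv Kv.
have hN : 0 <= h2 * N by rewrite mulr_ge0.
rewrite -(@ler_pXn2r _ 2)// ?nnegrE ?vnorm_ge0 ?mulr_ge0//.
rewrite (vnorm_factor_sqr HD) (le_trans (rdot_le _ _))//.
have -> : H1 *m (H2 *m v) = K *m v + H2 *m (H1 *m v).
  by rewrite /mxcomm mulmxBl !mulmxA subrK.
have hK := vnormD (K *m v) (H2 *m (H1 *m v)).
rewrite [leRHS](_ : _ = h2 * N * (4 * (h2 * N))); last by ring.
by rewrite ler_pM ?vnorm_ge0//; lra.
Qed.

(* Subtracting [c(s) E2(-be) K u], with [c] vanishing at both ends and
   [c' = f1(o) f2(o) (s - o)], removes the first-order part of [y']. *)
Lemma second_order_variation (P S n0 : R) : 1 <= P -> 0 <= S -> 0 <= n0 ->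
  C1 <= P -> C2 <= P -> opnorm H2 <= P ->
  let h := z - x in let o := x + h / 2 in
  `|f1 o| <= P -> `|f2 o| <= P ->
  (forall s, s \in `]x, z[ -> [/\ `|f2 s| <= P, `|th s| <= 2 * P * h,
    `|th s - f1 o * (s - o)| <= 2 * P * h ^+ 2 & `|f2 s - f2 o| <= P * h]) ->
  (forall s, s \in `]x, z[ -> vnorm (H1 *m psi s) <= S /\ vnorm (psi s) <= n0) ->
  vnorm (y z - y x) <= 15 * P ^+ 5 * (S + n0) * h ^+ 3.
Proof.
move=> P1 S0 n00 C1P C2P H2P h o f1o f2o hb hpb; set N := S + n0.
have P0 : 0 <= P by rewrite (le_trans _ P1).
have N0 : 0 <= N by rewrite addr_ge0.
have h0 : 0 <= h by rewrite subr_ge0.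
pose g := f1 o * f2 o.
pose c s := g / 2 * ((s - o) * (s - o) - (h / 2) ^+ 2).
pose dc s := g * (s - o).
have hc : rdiff x z c dc.
  have ho := rdiffB (rdiff_id x z) (rdiff_cst x z o).
  apply: eq_rdiff (rdiffM (rdiff_cst x z (g / 2))
    (rdiffB (rdiffM ho ho) (rdiff_cst x z ((h / 2) ^+ 2)))) => // s _.
  by rewrite /dc; field.
have cx : c x = 0 by rewrite /c /o; field.
have cz : c z = 0 by rewrite /c /o /h; field.
pose w s := E2 (- be s) *m (K *m u s).
pose du s := - cI R *: (cR (f2 s) *: (E1 (- th s) *m (H2 *m psi s))).
pose dw s := cI R *: (cR (f2 s) *: (E2 (- be s) *m (H2 *m (K *m u s))))
  + E2 (- be s) *m (K *m du s).
have hw : mdiff x z w dw.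
  apply: eq_mdiff (mdiffM (mdiff_propN hE2 rdiff_be) (mdiffMl K mdiff_u)) => [//|s _].
  by rewrite /dw -(prop_comm hH2 hE2) -!scalemxAl -mulmxA.
(* The second-order remainder of the conjugation, to be bounded by the double commutator. *)
pose r s := E1 (- th s) *m (H2 *m (E1 (th s) *m u s)) - H2 *m u s
  - cR (th s) *: (cI R *: (K *m u s)).
(* Since [-i * i = 1], the linear part of the conjugation contributes [f2 th w] to [y'], where it
   meets [- dc w] from the correction. *)
pose dPhi s := - (cI R *: (cR (f2 s) *: (E2 (- be s) *m r s)))
  + cR (f2 s * th s - dc s) *: w s - cR (c s) *: dw s.
have hPhi : mdiff x z (fun s => y s - cR (c s) *: w s) dPhi.
  apply: eq_mdiff (mdiffB mdiff_y (mdiffZR hc hw)) => [//|s _].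
  rewrite /dPhi /r -psi_u !mulmxBr -!scalemxAr -/(w s).
  rewrite (cRD (f2 s * th s)) (cRN (dc s)) (cRM (f2 s) (th s)).
  move: (E2 _ *m (E1 _ *m _)) (E2 _ *m (H2 *m _)) (w s) (dw s) => v1 v2 v3 v4.
  apply/matrixP => i j; rewrite !mxE.
  have := cIcI R; move: (cI R) => I.
  by move: (cR (f2 s)) (cR (th s)) (cR (dc s)) (cR (c s)) => a1 a2 a3 a4 II; ring: II.
have -> : y z - y x = (y z - cR (c z) *: w z) - (y x - cR (c x) *: w x).
  by rewrite cx cz cR0 !scale0r !subr0.
have -> : 15 * P ^+ 5 * N * h ^+ 3 = (15 * P ^+ 5 * N * h ^+ 2) * (z - x).
  by rewrite -/h; ring.
have PN : 0 <= P * N by rewrite mulr_ge0.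
apply: mdiff_mvt hPhi _ => //; first by rewrite !mulr_ge0// exprn_ge0.
move=> s sxz.
have [f2P thP tho f2h] := hb _ sxz; have [HS pn] := hpb _ sxz.
(* A geometric mean of two quantities below [N] is below [N]. *)
have Dpsi : vnorm (D1 *m psi s) <= N.
  rewrite (le_trans (vnorm_factor HD _))// -[leRHS](ger0_norm N0) -sqrtr_sqr.
  rewrite ler_wsqrtr// expr2 ler_pM ?vnorm_ge0// /N.
    by rewrite (le_trans pn)// lerDr.
  by rewrite (le_trans HS)// lerDl.
have pN : vnorm (psi s) <= N by rewrite (le_trans pn)// lerDr.
have HN : vnorm (H1 *m psi s) <= N by rewrite (le_trans HS)// lerDl.
have H2b v b : vnorm v <= b -> vnorm (H2 *m v) <= P * b.
  by move=> vb; rewrite (le_trans (vnorm_mulmx _ _))// ler_pM ?opnorm_ge0 ?vnorm_ge0.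
have C1b v b : vnorm (D1 *m v) + vnorm v <= b -> vnorm (K *m v) <= P * b.
  move=> vb; rewrite (le_trans (hC1 v))// ler_pM//.
  by rewrite addr_ge0 ?vnorm_ge0.
have Ku : vnorm (K *m u s) <= P * (2 * N).
  by apply: C1b; rewrite vnorm_D1_u vnorm_u; lra.
have Kpsi : vnorm (K *m psi s) <= P * (2 * N) by apply: C1b; lra.
have rb : vnorm (r s) <= 4 * P ^+ 3 * N * h ^+ 2.
  apply: le_trans (prop_conj_taylor2 hH1 hE1 (th s)
    (M := P * N) PN _) _.
    move=> t; rewrite (le_trans (vnorm_KK_prop _ _))// ler_pM//.
      by rewrite addr_ge0 ?vnorm_ge0.
    rewrite vnorm_u /u (prop_commV hH1 hE1) (prop_isometry hH1 hE1).
    by rewrite /N lerD.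
  have -> : 4 * P ^+ 3 * N * h ^+ 2 = P * N * (2 * P * h) ^+ 2 by ring.
  by rewrite ler_wpM2l// ler_pXn2r// nnegrE !mulr_ge0.
(* The derivative of the correction contains [K u']. Bounding it calls for [D1 H2 psi], which is
   controlled by commuting [H1] past [H2]. *)
have dub : vnorm (D1 *m du s) + vnorm (du s) <= 3 * (P ^+ 2 * N).
  have DH : vnorm (D1 *m (H2 *m psi s)) <= 2 * (P * N).
    by apply: vnorm_D1_H2 => //; [exact: H2b|exact: H2b|lra].
  have HP : vnorm (H2 *m psi s) <= P * N by exact: H2b.
  have e : 3 * (P ^+ 2 * N) = P * (2 * (P * N)) + P * (P * N) by ring.
  rewrite /du e !scaleNr mulmxN -!scalemxAr !vnormN !vnormZI !vnormZR.
  rewrite (vnorm_factor_prop hH1 hE1 HD) (prop_isometry hH1 hE1).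
  by rewrite lerD// ler_pM ?vnorm_ge0.
have dwb : vnorm (dw s) <= 5 * P ^+ 3 * N.
  have e : 5 * P ^+ 3 * N = P * (P * (P * (2 * N))) + P * (3 * (P ^+ 2 * N)) by ring.
  rewrite e (le_trans (vnormD _ _))// lerD//.
    rewrite vnormZI vnormZR ler_pM ?vnorm_ge0// (prop_isometry hH2 hE2).
    exact: H2b.
  by rewrite (prop_isometry hH2 hE2); exact: C1b.
have so : `|s - o| <= h / 2.
  by move: sxz; rewrite in_itv/= ler_norml /o /h => /andP[? ?]; apply/andP; split; lra.
have so2 : `|s - o| <= h by rewrite (le_trans so)//; lra.
have gP : `|g| <= P * P by rewrite normrM ler_pM.
have cb : `|c s| <= P ^+ 2 * h ^+ 2.
  rewrite /c normrM; have -> : P ^+ 2 * h ^+ 2 = (P * P) * h ^+ 2 by ring.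
  rewrite ler_pM//.
    rewrite normrM normfV (ger0_norm (_ : 0 <= 2))//.
    by have := normr_ge0 g; move: gP; lra.
  have q0 : 0 <= (s - o) * (s - o) by rewrite -expr2 sqr_ge0.
  have q1 : (s - o) * (s - o) <= h / 2 * (h / 2).
    rewrite -[leLHS]ger0_norm// normrM ler_pM//.
  have q2 : 0 <= h * h by rewrite mulr_ge0.
  by rewrite ler_norml; apply/andP; split; lra.
(* Replace first [th] by its linearization at the midpoint, then [f2] by [f2 o]; both replacements
   cost [O(h^2)]. *)
have db : `|f2 s * th s - dc s| <= 3 * P ^+ 2 * h ^+ 2.
  have -> : f2 s * th s - dc s = f2 s * (th s - f1 o * (s - o))
      + f1 o * (s - o) * (f2 s - f2 o) by rewrite /dc /g; ring.
  have -> : 3 * P ^+ 2 * h ^+ 2 = P * (2 * P * h ^+ 2) + P * h * (P * h) by ring.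
  rewrite (le_trans (ler_normD _ _))// lerD// normrM ler_pM//.
  by rewrite normrM ler_pM.
have wb : vnorm (w s) <= P * (2 * N) by rewrite /w (prop_isometry hH2 hE2).
apply: (@le_trans _ _ (P * (4 * P ^+ 3 * N * h ^+ 2)
  + 3 * P ^+ 2 * h ^+ 2 * (P * (2 * N)) + P ^+ 2 * h ^+ 2 * (5 * P ^+ 3 * N))).
  rewrite (le_trans (vnormB _ _))// lerD//; last first.
    by rewrite vnormZR ler_pM ?vnorm_ge0.
  rewrite (le_trans (vnormD _ _))// lerD//; last first.
    by rewrite vnormZR ler_pM ?vnorm_ge0.
  rewrite vnormN vnormZI vnormZR ler_pM ?vnorm_ge0//.
  by rewrite (prop_isometry hH2 hE2).
have hN : 0 <= h ^+ 2 * N by rewrite mulr_ge0// sqr_ge0.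
(* The contributions [4 P^4], [6 P^3] and [5 P^5] merge into [15 P^5] because [P >= 1]. *)
have P34 : P ^+ 3 <= P ^+ 5 by rewrite ler_weXn2l.
have P45 : P ^+ 4 <= P ^+ 5 by rewrite ler_weXn2l.
have -> : P * (4 * P ^+ 3 * N * h ^+ 2) + 3 * P ^+ 2 * h ^+ 2 * (P * (2 * N))
  + P ^+ 2 * h ^+ 2 * (5 * P ^+ 3 * N) =
  (4 * P ^+ 4 + 6 * P ^+ 3 + 5 * P ^+ 5) * (h ^+ 2 * N) by ring.
have -> : 15 * P ^+ 5 * N * h ^+ 2 = 15 * P ^+ 5 * (h ^+ 2 * N) by ring.
by rewrite ler_wpM2r//; lra.
Qed.

End LocalError.

(** * Exact evolution, primitives, and accumulation of local errors *)

Section Evolution.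
Variable R : realType.
Local Notation C := R[i].

Lemma is_derive_coord m n (M : R -> 'M[R]_(m, n)) (t : R) dM i j :
  is_derive t 1 M dM -> is_derive t 1 (fun s => M s i j) (dM i j).
Proof.
move=> [DM <-]; have := (derivable_mxP M t 1).1 DM i j => Dij.
by split => //; rewrite derive_mx// mxE.
Qed.

Lemma rdiff_coord m n (a b : R) (M dM : R -> 'M[R]_(m, n)) i j :
  {within `[a, b], continuous M} ->
  (forall t, t \in `]a, b[ -> is_derive t 1 M (dM t)) ->
  rdiff a b (fun s => M s i j) (fun s => dM s i j).
Proof.
move=> cM DM; split => [t|t /DM]; last exact: is_derive_coord.
exact: (cvg_comp _ _ (cM t) (@coord_continuous _ _ _ i j _)).
Qed.

Lemma evolution_mdiff n (T : R) (H U : R -> 'M[C]_n) : is_evolution T H U ->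
  mdiff 0 T U (fun t => - cI R *: (H t *m U t)).
Proof.
move=> [_ cRe cIm D] i j.
have h1 := rdiff_coord (dM := fun t => Re_mx (- cI R *: (H t *m U t))) i j
  cRe (fun t tt => (D t tt).1).
have h2 := rdiff_coord (dM := fun t => Im_mx (- cI R *: (H t *m U t))) i j
  cIm (fun t tt => (D t tt).2).
by split; [apply: eq_rdiff h1|apply: eq_rdiff h2] => t *; rewrite mxE.
Qed.

(** Fundamental theorem of calculus. A single primitive based at [0] serves all subintervals, so the
    integrals in the generalized schemes become exact increments. *)
Lemma antiderivative (T : R) (f : R -> R) : 0 < T ->
  {within `[0, T], continuous f} ->
  exists2 F : R -> R, rdiff 0 T F f &
    forall a b, 0 <= a -> a <= b -> b <= T -> Defs.Rint a b f = F b - F a.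
Proof.
move=> T0 cf; pose mu := @lebesgue_measure R.
have fi : mu.-integrable `[0, T] (EFin \o f).
  by apply: continuous_compact_integrable => //; exact: segment_compact.
exists (fun s => Defs.Rint 0 s f).
  split; first exact: (parameterized_integral_continuous (ltW T0) fi).
  move=> t /[!in_itv]/= /andP[t0 tT].
  have fc : {for t, continuous f}.
    have /(continuous_within_itvP _ T0)[+ _ _] := cf.
    by apply; rewrite in_itv/= t0 tT.
  have [D e] := continuous_FTC1_closed tT fi t0 fc.
  by split; rewrite ?derive1E in e *.
move=> a b a0 ab bT; rewrite /Defs.Rint.
have ib : mu.-integrable `[0, b] (EFin \o f).
  by apply: integrableS fi => //; apply: subset_itvScc; rewrite bnd_simp.
rewrite Rintegral_itvB ?bnd_simp// ?(le_trans a0 ab)//.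
rewrite Rintegral_itv_obnd_cbnd//.
apply: integrableS ib => //; apply: subset_itvr.
by rewrite bnd_simp.
Qed.

Lemma supnorm_ub (T : R) (f : R -> R) (M : R) :
  (forall t, t \in `[0, T] -> `|f t| <= M) ->
  forall t, t \in `[0, T] -> `|f t| <= supnorm T f.
Proof.
move=> hM t tT; apply: ub_le_sup; last by exists t.
by exists M => _ [s /= sT <-]; exact: hM.
Qed.

Lemma supnorm_ge0 (T : R) (f : R -> R) (M : R) : 0 < T ->
  (forall t, t \in `[0, T] -> `|f t| <= M) -> 0 <= supnorm T f.
Proof.
move=> T0 hM; apply: le_trans (normr_ge0 (f 0)) (supnorm_ub hM _).
by rewrite in_itv/= lexx ltW.
Qed.

(** * Errors of one-point quadrature rules *)

Section Quadrature.
Variables (x z P : R) (F f df ddf : R -> R).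
Hypotheses (xz : x <= z) (P0 : 0 <= P).
Hypotheses (hF : rdiff x z F f) (hf : rdiff x z f df) (hdf : rdiff x z df ddf).
Hypothesis dfP : forall t, t \in `]x, z[ -> `|df t| <= P.
Let h := z - x.

Lemma dist_segment : {in `[x, z] &, forall s o, `|s - o| <= h}.
Proof.
move=> s o /[!in_itv]/= /andP[? ?] /andP[? ?]; rewrite ler_norml /h.
by apply/andP; split; lra.
Qed.

(** The error is the increment of a function with derivative [f - f o], itself at most [P h]. *)
Lemma quadrature1 : {in `[x, z] &, forall s o,
  `|F s - F o - f o * (s - o)| <= P * h ^+ 2}.
Proof.
move=> s o sI oI; have h0 : 0 <= h by rewrite subr_ge0.
pose G t := F t - f o * t.
have hG : rdiff x z G (fun t => f t - f o).
  apply: eq_rdiff (rdiffB hF (rdiffM (rdiff_cst x z (f o)) (rdiff_id x z))) => // t _.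
  by rewrite mul0r add0r mulr1.
have -> : F s - F o - f o * (s - o) = G s - G o by rewrite /G; ring.
have Ph : 0 <= P * h by rewrite mulr_ge0.
rewrite (le_trans (rdiff_lipschitz Ph hG _ oI sI))//.
  move=> t tI; have tI' : t \in `[x, z] by exact: subset_itv_oo_cc.
  rewrite (le_trans (rdiff_lipschitz P0 hf dfP oI tI'))// ler_wpM2l//.
  exact: dist_segment.
by rewrite expr2 mulrA ler_wpM2l// dist_segment.
Qed.

(** The second-order Taylor term at the midpoint takes the same value at both ends, so it can be
    subtracted from [F] for free; what is left has derivative [O(h^2)]. *)
Lemma midpoint_rule : let o := x + h / 2 in
  (forall t, t \in `]x, z[ -> `|ddf t| <= P) ->
  `|F z - F x - f o * h| <= P * h ^+ 3.
Proof.
move=> o ddfP; have h0 : 0 <= h by rewrite subr_ge0.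
have oI : o \in `[x, z].
  by rewrite in_itv/= /o; apply/andP; split; move: h0; rewrite /h; lra.
have xI : x \in `[x, z] by rewrite in_itv/= lexx.
have zI : z \in `[x, z] by rewrite in_itv/= lexx andbT.
pose g t := f t - df o * t.
have hg : rdiff x z g (fun t => df t - df o).
  apply: eq_rdiff (rdiffB hf (rdiffM (rdiff_cst x z (df o)) (rdiff_id x z))) => // t _.
  by rewrite mul0r add0r mulr1.
pose G t := F t - f o * t - df o / 2 * ((t - o) * (t - o)).
have hG : rdiff x z G (fun t => f t - f o - df o * (t - o)).
  have ho := rdiffB (rdiff_id x z) (rdiff_cst x z o).
  apply: eq_rdiff (rdiffB (rdiffB hF (rdiffM (rdiff_cst x z (f o)) (rdiff_id x z)))
    (rdiffM (rdiff_cst x z (df o / 2)) (rdiffM ho ho))) => // t _.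
  by field.
have Ph : 0 <= P * h by rewrite mulr_ge0.
have Phh : 0 <= P * h ^+ 2 by rewrite mulr_ge0// sqr_ge0.
have -> : F z - F x - f o * h = G z - G x by rewrite /G /o /h; field.
rewrite (le_trans (rdiff_lipschitz Phh hG _ xI zI))//; last first.
  by rewrite (exprSr h 2) mulrA ler_wpM2l// dist_segment.
move=> t tI; have tI' : t \in `[x, z] by exact: subset_itv_oo_cc.
have -> : f t - f o - df o * (t - o) = g t - g o by rewrite /g; ring.
rewrite (le_trans (rdiff_lipschitz Ph hg _ oI tI'))//.
  move=> s sI; have sI' : s \in `[x, z] by exact: subset_itv_oo_cc.
  rewrite (le_trans (rdiff_lipschitz P0 hdf ddfP oI sI'))// ler_wpM2l//.
  exact: dist_segment.
by rewrite expr2 mulrA ler_wpM2l// dist_segment.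
Qed.

End Quadrature.

(** An isometric step carries the accumulated error along unchanged and adds one local error,
    measured from the exact state. *)
Lemma trotter_error n (step : R -> 'M[C]_n) (h e : R) (L : nat)
    (psi : R -> 'cV[C]_n) :
  (forall t v, vnorm (step t *m v) = vnorm v) ->
  (forall k, (k < L)%N ->
    vnorm (step (k%:R * h) *m psi (k%:R * h) - psi (k%:R * h + h)) <= e) ->
  vnorm (trotter step h L *m psi 0 - psi (L%:R * h)) <= L%:R * e.
Proof.
move=> iso; elim: L => [|L IH] he.
  by rewrite /= mul1mx !mul0r subrr vnorm0.
rewrite /= -mulmxA -[L.+1]addn1 natrD !mulrDl !mul1r.
rewrite -(subrKA (step (L%:R * h) *m psi (L%:R * h))) -mulmxBr.
rewrite (le_trans (vnormD _ _))// lerD// ?iso; last exact: he.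
by apply: IH => k kL; apply: he; exact: ltn_trans kL _.
Qed.

End Evolution.

(** * Local and global bounds in terms of one parameter [P >= 1] *)

Section GlobalError.
Variable R : realType.
Local Notation C := R[i].
Variables (n m : nat) (H1 H2 : 'M[C]_n) (D1 : 'M[C]_(m, n)).
Variables (E1 E2 : R -> 'M[C]_n) (C1 C2 T P : R).
Hypotheses (hH1 : is_hermitian H1) (hH2 : is_hermitian H2).
Hypotheses (hE1 : propagator H1 E1) (hE2 : propagator H2 E2).
Hypothesis HD : H1 = mx_adj D1 *m D1.
Local Notation K := (mxcomm H1 H2).
Hypothesis hC1 : forall v, vnorm (K *m v) <= C1 * (vnorm (D1 *m v) + vnorm v).
Hypothesis hC2 : forall v,
  vnorm (mxcomm H1 K *m v) <= C2 * (vnorm (H1 *m v) + vnorm v).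
Hypotheses (C1_ge0 : 0 <= C1) (C2_ge0 : 0 <= C2) (T_ge0 : 0 <= T).
Hypotheses (P1 : 1 <= P) (C1P : C1 <= P) (C2P : C2 <= P) (H2P : opnorm H2 <= P).

Variables (f1 df1 f2 df2 F1 F2 : R -> R) (psi : R -> 'cV[C]_n) (n0 S : R).
Hypotheses (hF1 : rdiff 0 T F1 f1) (hF2 : rdiff 0 T F2 f2).
Hypotheses (hf1 : rdiff 0 T f1 df1) (hf2 : rdiff 0 T f2 df2).
Hypothesis f1P : forall t, t \in `[0, T] -> `|f1 t| <= P.
Hypothesis f2P : forall t, t \in `[0, T] -> `|f2 t| <= P.
Hypothesis df1P : forall t, t \in `[0, T] -> `|df1 t| <= P.
Hypothesis df2P : forall t, t \in `[0, T] -> `|df2 t| <= P.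
Hypothesis hpsi :
  mdiff 0 T psi (fun s => - cI R *: (Ham f1 f2 H1 H2 s *m psi s)).
Hypothesis psin : forall t, t \in `[0, T] -> vnorm (psi t) = n0.
Hypothesis psiS : forall t, t \in `[0, T] -> vnorm (H1 *m psi t) <= S.

Variables (h : R) (p q al : R -> R).
Hypothesis h0 : 0 <= h.

(** The common form of the four schemes; the first-order ones take [p = 0]. *)
Let step t := E1 (p t) *m (E2 (q t) *m E1 (al t)).

Lemma step_isometry t v : vnorm (step t *m v) = vnorm v.
Proof.
by rewrite /step -!mulmxA (prop_isometry hH1 hE1) (prop_isometry hH2 hE2)
  (prop_isometry hH1 hE1).
Qed.

Let n0_ge0 : 0 <= n0.
Proof. by rewrite -(psin (t := 0)) ?vnorm_ge0// in_itv/= lexx. Qed.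

Let S_ge0 : 0 <= S.
Proof.
by rewrite (le_trans (vnorm_ge0 _) (psiS (t := 0) _))// in_itv/= lexx.
Qed.

Let P_ge0 : 0 <= P. Proof. by rewrite (le_trans _ P1). Qed.

Section Step.
Variable t : R.
Hypotheses (t0 : 0 <= t) (tT : t + h <= T).

Let sub s : s \in `[t, t + h] -> s \in `[0, T].
Proof.
by move=> /[!in_itv]/= /andP[a b]; rewrite (le_trans t0 a) (le_trans b tT).
Qed.

Let subo s : s \in `]t, t + h[ -> s \in `[0, T].
Proof. by move=> /subset_itv_oo_cc; exact: sub. Qed.

Let tth : t <= t + h. Proof. by rewrite lerDl. Qed.

Let hh : t + h - t = h. Proof. by rewrite addrAC subrr add0r. Qed.

Let tI : t \in `[t, t + h]. Proof. by rewrite in_itv/= lexx. Qed.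

Let zI : t + h \in `[t, t + h]. Proof. by rewrite in_itv/= lexx andbT. Qed.

Lemma F1_lipschitz s o : s \in `[t, t + h] -> o \in `[t, t + h] ->
  `|F1 s - F1 o| <= P * h.
Proof.
move=> sI oI; rewrite (le_trans (rdiff_lipschitz P_ge0
  (rdiff_subset t0 tT hF1) (fun r rI => f1P (subo rI)) oI sI))//.
by rewrite ler_wpM2l// -[leRHS]hh dist_segment.
Qed.

(** The bound [Q] on [|D1 psi|] is kept apart from [S]: when the quadrature error [e1] vanishes, [S]
    drops out and a square-root bound survives. *)
Lemma first_order_step (Q e1 e2 : R) : 0 <= Q ->
  (forall s, s \in `[0, T] -> vnorm (D1 *m psi s) <= Q) ->
  `|al t| <= P * h -> `|q t - (F2 (t + h) - F2 t)| <= e2 ->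
  `|p t + al t - (F1 (t + h) - F1 t)| <= e1 ->
  vnorm (step t *m psi t - psi (t + h)) <=
  2 * P ^+ 3 * (Q + n0) * h ^+ 2 + e2 * (P * n0) + e1 * S.
Proof.
move=> Q0 DQ alP qe pe.
have hF1' := rdiff_subset t0 tT hF1; have hF2' := rdiff_subset t0 tT hF2.
have hpsi' := mdiff_subset t0 tT hpsi.
rewrite /step -!mulmxA.
rewrite (le_trans (step_error hH1 hH2 hE1 hE2 t (t + h) F1 F2 psi (p t) (q t) (al t)))//.
apply: lerD; first apply: lerD.
- have := first_order_variation hH1 hH2 hE1 hE2 HD hC1 C1_ge0 (al := al t) tth
    hF1' hF2' hpsi' (P := P) (Th := 2 * P * h) (Q := Q) (n0 := n0).
  move/(_ P_ge0) => H; apply: le_trans (H _ _ _ _) _ => //.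
  + by rewrite !mulr_ge0.
  + move=> s sI; split; [exact: f2P (subo sI)| |exact: DQ (subo sI)|].
      rewrite (le_trans (ler_normB _ _))//.
      have := F1_lipschitz (subset_itv_oo_cc sI) tI; lra.
    by rewrite psin// subo.
  + rewrite hh.
    have -> : 2 * P ^+ 3 * (Q + n0) * h ^+ 2 = P * (P * (Q + n0) * (2 * P * h)) * h.
      by ring.
    rewrite ler_wpM2r// ler_wpM2l// ler_wpM2r ?mulr_ge0//.
    by rewrite ler_wpM2r// addr_ge0.
- rewrite ler_pM ?mulr_ge0 ?opnorm_ge0 ?vnorm_ge0// psin ?sub//.
  by rewrite ler_wpM2r.
- by rewrite ler_pM ?vnorm_ge0// psiS// sub.
Qed.

(** The hypothesis that [al] matches the integral of [f1] over the first half step up to [O(h^2)]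
    makes [th] nearly odd about the midpoint. *)
Lemma second_order_step (e : R) : let o := t + h / 2 in
  `|al t| <= P * h -> `|al t - (F1 o - F1 t)| <= P * h ^+ 2 ->
  `|q t - (F2 (t + h) - F2 t)| <= e ->
  `|p t + al t - (F1 (t + h) - F1 t)| <= e ->
  vnorm (step t *m psi t - psi (t + h)) <=
  15 * P ^+ 5 * (S + n0) * h ^+ 3 + e * (P * n0) + e * S.
Proof.
move=> o alP alo qe pe.
have hF1' := rdiff_subset t0 tT hF1; have hF2' := rdiff_subset t0 tT hF2.
have hpsi' := mdiff_subset t0 tT hpsi.
have oI : o \in `[t, t + h].
  by rewrite in_itv/= /o; apply/andP; split; move: h0; lra.
rewrite /step -!mulmxA.
rewrite (le_trans (step_error hH1 hH2 hE1 hE2 t (t + h) F1 F2 psi (p t) (q t) (al t)))//.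
apply: lerD; first apply: lerD.
- have := second_order_variation hH1 hH2 hE1 hE2 HD hC1 hC2 C1_ge0 C2_ge0
    (al := al t) tth hF1' hF2' hpsi' P1 S_ge0 n0_ge0 C1P C2P H2P.
  rewrite hh -/o; apply.
  + by rewrite f1P// sub.
  + by rewrite f2P// sub.
  + move=> s sI; have sI' := subset_itv_oo_cc sI.
    have dd := rdiff_subset t0 tT hf2.
    split; first exact: f2P (subo sI).
    * rewrite (le_trans (ler_normB _ _))//.
      have := F1_lipschitz sI' tI; lra.
    * have Q1 := quadrature1 tth P_ge0 hF1' (rdiff_subset t0 tT hf1)
        (fun r rI => df1P (subo rI)) sI' oI.
      rewrite hh in Q1.
      (* One [P h^2] comes from linearizing [F1] at the midpoint, the other from the error in
         [al]. *)
      have -> : F1 s - F1 t - al t - f1 o * (s - o) =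
        (F1 s - F1 o - f1 o * (s - o)) - (al t - (F1 o - F1 t)) by ring.
      by rewrite (le_trans (ler_normB _ _))//; lra.
    * rewrite (le_trans (rdiff_lipschitz P_ge0 dd
        (fun r rI => df2P (subo rI)) oI sI'))//.
      by rewrite ler_wpM2l// -[leRHS]hh dist_segment.
  + by move=> s sI; rewrite psiS ?psin ?subo.
- rewrite ler_pM ?mulr_ge0 ?opnorm_ge0 ?vnorm_ge0// psin ?sub//.
  by rewrite ler_wpM2r.
- by rewrite ler_pM ?vnorm_ge0// psiS// sub.
Qed.

End Step.

Variable L : nat.
Hypothesis hL : L%:R * h = T.

Lemma grid_ge0 k : 0 <= k%:R * h. Proof. by rewrite mulr_ge0. Qed.

Lemma grid_le k : (k < L)%N -> k%:R * h + h <= T.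
Proof.
move=> kL; rewrite -hL -{2}(mul1r h) -mulrDl ler_wpM2r// natr1.
by rewrite ler_nat.
Qed.

Lemma global_error e :
  (forall t, 0 <= t -> t + h <= T ->
    vnorm (step t *m psi t - psi (t + h)) <= e) ->
  vnorm (trotter step h L *m psi 0 - psi T) <= L%:R * e.
Proof.
move=> he; rewrite -hL; apply: trotter_error => [t v|k kL].
  exact: step_isometry.
by apply: he; [exact: grid_ge0|exact: grid_le].
Qed.

End GlobalError.

(** * Norm conservation, regularity data and numerical constants *)

Section Assembly.
Variable R : realType.
Local Notation C := R[i].

Lemma Ham_hermitian n (f1 f2 : R -> R) (H1 H2 : 'M[C]_n) t :
  is_hermitian H1 -> is_hermitian H2 -> is_hermitian (Ham f1 f2 H1 H2 t).
Proof.
have conjR (x : R) : conjc (cR x) = cR x by rewrite /cR /= oppr0.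
by move=> h1 h2; rewrite /is_hermitian /Ham mx_adjD !mx_adjZ !conjR h1 h2.
Qed.

Lemma evolution_isometry n (T : R) (f1 f2 : R -> R) (H1 H2 : 'M[C]_n) U psi0 :
  is_hermitian H1 -> is_hermitian H2 ->
  is_evolution T (Ham f1 f2 H1 H2) U ->
  forall t, t \in `[0, T] -> vnorm (U t *m psi0) = vnorm psi0.
Proof.
move=> h1 h2 hU t /[!in_itv]/= /andP[t0 tT].
have [U0 _ _ _] := hU.
rewrite -[in RHS](mul1mx psi0) -U0.
have hpsi := mdiffMr psi0 (mdiff_subset (lexx 0) tT (evolution_mdiff hU)).
apply: (@vnorm_conserved _ 0 t _ (Ham f1 f2 H1 H2) (fun t => U t *m psi0)) => //.
  by move=> s _; exact: Ham_hermitian.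
by apply: eq_mdiff hpsi => [//|s _]; rewrite -scalemxAl mulmxA.
Qed.

Lemma C2_on_rdiff (T : R) (f df ddf : R -> R) : 0 < T -> C2_on T f df ddf ->
  [/\ rdiff 0 T f df, rdiff 0 T df ddf,
      [/\ 0 <= supnorm T f, 0 <= supnorm T df & 0 <= supnorm T ddf] &
      forall t, t \in `[0, T] -> [/\ `|f t| <= supnorm T f,
        `|df t| <= supnorm T df & `|ddf t| <= supnorm T ddf]].
Proof.
move=> T0 [cf cdf _ D [M hM]].
have b0 t : t \in `[0, T] -> `|f t| <= M by move/hM => [].
have b1 t : t \in `[0, T] -> `|df t| <= M by move/hM => [].
have b2 t : t \in `[0, T] -> `|ddf t| <= M by move/hM => [].
split.
- by split=> // t /D[].
- by split=> // t /D[].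
- by split; [exact: supnorm_ge0 b0|exact: supnorm_ge0 b1|exact: supnorm_ge0 b2].
- by move=> t tT; split; [exact: supnorm_ub b0 _ tT|exact: supnorm_ub b1 _ tT
    |exact: supnorm_ub b2 _ tT].
Qed.

(** Sums [l] local errors of (s,1), with [Q = S + n0] and quadrature errors [P h^2]. Once powers of
    [P] are raised to [P^5], the coefficients are [3] for [S] and [5] for [n0]. *)
Lemma first_order_constant (P S n0 h l : R) : 1 <= P -> 0 <= S -> 0 <= n0 ->
  0 <= l ->
  l * (2 * P ^+ 3 * (S + n0 + n0) * h ^+ 2 + P * h ^+ 2 * (P * n0) + P * h ^+ 2 * S)
  <= 20 * P ^+ 5 * (l * h ^+ 2) * (S + n0).
Proof.
move=> P1 S0 n00 l0.
have P0 : 0 <= P by rewrite (le_trans _ P1).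
have X0 : 0 <= l * h ^+ 2 by rewrite mulr_ge0// sqr_ge0.
have P3 : P ^+ 3 <= P ^+ 5 by rewrite ler_weXn2l.
have P2 : P ^+ 2 <= P ^+ 5 by rewrite ler_weXn2l.
have Q1 : P ^+ 1 <= P ^+ 5 by rewrite ler_weXn2l.
have P5 : 0 <= P ^+ 5 by rewrite exprn_ge0.
rewrite [leLHS](_ : _ = l * h ^+ 2 * (2 * (P ^+ 3 * (S + n0 + n0)) + P ^+ 2 * n0
  + P ^+ 1 * S)); last by ring.
rewrite [leRHS](_ : _ = l * h ^+ 2 * (20 * (P ^+ 5 * S) + 20 * (P ^+ 5 * n0)));
  last by ring.
rewrite ler_wpM2l//.
have A1 : P ^+ 3 * (S + n0 + n0) <= P ^+ 5 * (S + n0 + n0).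
  by rewrite ler_wpM2r// !addr_ge0.
have A2 : P ^+ 2 * n0 <= P ^+ 5 * n0 by rewrite ler_wpM2r.
have A3 : P ^+ 1 * S <= P ^+ 5 * S by rewrite ler_wpM2r.
have A4 : 0 <= P ^+ 5 * S by rewrite mulr_ge0.
have A5 : 0 <= P ^+ 5 * n0 by rewrite mulr_ge0.
rewrite !mulrDr in A1; lra.
Qed.

(** Here the coefficients of both [S] and [n0] come to [16]; [20] is a common round value for all
    schemes. *)
Lemma second_order_constant (P S n0 h l : R) : 1 <= P -> 0 <= S -> 0 <= n0 ->
  0 <= l -> 0 <= h ->
  l * (15 * P ^+ 5 * (S + n0) * h ^+ 3 + P * h ^+ 3 * (P * n0) + P * h ^+ 3 * S)
  <= 20 * P ^+ 5 * (l * h ^+ 3) * (S + n0).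
Proof.
move=> P1 S0 n00 l0 h0.
have P0 : 0 <= P by rewrite (le_trans _ P1).
have X0 : 0 <= l * h ^+ 3 by rewrite mulr_ge0// exprn_ge0.
have P2 : P ^+ 2 <= P ^+ 5 by rewrite ler_weXn2l.
have Q1 : P ^+ 1 <= P ^+ 5 by rewrite ler_weXn2l.
have P5 : 0 <= P ^+ 5 by rewrite exprn_ge0.
rewrite [leLHS](_ : _ = l * h ^+ 3 * (15 * (P ^+ 5 * S) + 15 * (P ^+ 5 * n0)
  + P ^+ 2 * n0 + P ^+ 1 * S)); last by ring.
rewrite [leRHS](_ : _ = l * h ^+ 3 * (20 * (P ^+ 5 * S) + 20 * (P ^+ 5 * n0)));
  last by ring.
rewrite ler_wpM2l//.
have A2 : P ^+ 2 * n0 <= P ^+ 5 * n0 by rewrite ler_wpM2r.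
have A3 : P ^+ 1 * S <= P ^+ 5 * S by rewrite ler_wpM2r.
have A4 : 0 <= P ^+ 5 * S by rewrite mulr_ge0.
have A5 : 0 <= P ^+ 5 * n0 by rewrite mulr_ge0.
lra.
Qed.

End Assembly.

(** * The error bounds for the four schemes *)

Theorem theorem4 (R : realType) :
  exists (c : R) (k : nat),
  forall (n m : nat) (H1 H2 : 'M[R[i]]_n) (D1 : 'M[R[i]]_(m, n))
         (T : R) (f1 df1 ddf1 f2 df2 ddf2 : R -> R) (C1 C2 : R)
         (U : R -> 'M[R[i]]_n) (L : nat) (psi0 : 'cV[R[i]]_n),
    is_hermitian H1 -> is_hermitian H2 ->
    0 < T ->
    C2_on T f1 df1 ddf1 -> C2_on T f2 df2 ddf2 ->
    H1 = mx_adj D1 *m D1 ->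
    0 <= C1 -> 0 <= C2 ->
    (forall v : 'cV[R[i]]_n,
        vnorm (mxcomm H1 H2 *m v) <= C1 * (vnorm (D1 *m v) + vnorm v)) ->
    (forall v : 'cV[R[i]]_n,
        vnorm (mxcomm H1 (mxcomm H1 H2) *m v) <= C2 * (vnorm (H1 *m v) + vnorm v)) ->
    is_evolution T (Ham f1 f2 H1 H2) U ->
    (0 < L)%N ->
    let h := T / L%:R in
    (* h <= (||f1||oo + ||f2||oo)^-1 (C1 + ||H2||)^-1 / 2 *)
    2 * h * (supnorm T f1 + supnorm T f2) * (C1 + opnorm H2) <= 1 ->
    let Ct := c * (1 + opnorm H2
                     + supnorm T f1 + supnorm T df1 + supnorm T ddf1
                     + supnorm T f2 + supnorm T df2 + supnorm T ddf2
                     + C1 + C2) ^+ k in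
    let psi := fun t => U t *m psi0 in
    let S := sup [set vnorm (H1 *m psi t) | t in `[0, T]] in
    let Ssqrt := sup [set Num.sqrt (vnorm psi0 * vnorm (H1 *m psi t)) | t in `[0, T]] in
    [/\ vnorm (trotter (U_s1 f1 f2 H1 H2 h) h L *m psi0 - U T *m psi0)
          <= Ct * (T ^+ 2 / L%:R) * (S + vnorm psi0),
        vnorm (trotter (U_g1 f1 f2 H1 H2 h) h L *m psi0 - U T *m psi0)
          <= Ct * (T ^+ 2 / L%:R) * (Ssqrt + vnorm psi0),
        vnorm (trotter (U_s2 f1 f2 H1 H2 h) h L *m psi0 - U T *m psi0)
          <= Ct * (T ^+ 3 / (L ^ 2)%:R) * (S + vnorm psi0)
      & vnorm (trotter (U_g2 f1 f2 H1 H2 h) h L *m psi0 - U T *m psi0)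
          <= Ct * (T ^+ 3 / (L ^ 2)%:R) * (S + vnorm psi0)].
Proof.
(* The degree [5] is that of the second-order variation bound; the factor [20] dominates the sums of
   coefficients in both orders. *)
exists 20, 5%N => n m H1 H2 D1 T f1 df1 ddf1 f2 df2 ddf2 C1 C2 U L psi0.
move=> hH1 hH2 T0 hf1 hf2 HD C1_0 C2_0 hC1 hC2 hU L0 h _ Ct psi S Ssqrt.
have [F1 hF1 F1E] : exists2 F1 : R -> R, rdiff 0 T F1 f1 & forall a b,
    0 <= a -> a <= b -> b <= T -> Defs.Rint a b f1 = F1 b - F1 a.
  by case: hf1 => cf _ _ _ _; exact: antiderivative.
have [F2 hF2 F2E] : exists2 F2 : R -> R, rdiff 0 T F2 f2 & forall a b,
    0 <= a -> a <= b -> b <= T -> Defs.Rint a b f2 = F2 b - F2 a.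
  by case: hf2 => cf _ _ _ _; exact: antiderivative.
have [r1 dr1 [a10 a11 a12] b1] := C2_on_rdiff T0 hf1.
have [r2 dr2 [a20 a21 a22] b2] := C2_on_rdiff T0 hf2.
have o0 := opnorm_ge0 H2.
(* One number dominates every norm in play, and the summand [1] lets lower powers be absorbed into
   [P^5]. *)
move: @Ct; set P := (1 + opnorm H2 + _ + _ + _ + _ + _ + _ + C1 + C2) => Ct.
have P1 : 1 <= P by rewrite /P; lra.
have P0 : 0 <= P by rewrite (le_trans _ P1).
have C1P : C1 <= P by rewrite /P; lra.
have C2P : C2 <= P by rewrite /P; lra.
have H2P : opnorm H2 <= P by rewrite /P; lra.
have f1P t : t \in `[0, T] -> `|f1 t| <= P.
  by move=> /b1[b _ _]; rewrite (le_trans b)// /P; lra.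
have df1P t : t \in `[0, T] -> `|df1 t| <= P.
  by move=> /b1[_ b _]; rewrite (le_trans b)// /P; lra.
have ddf1P t : t \in `[0, T] -> `|ddf1 t| <= P.
  by move=> /b1[_ _ b]; rewrite (le_trans b)// /P; lra.
have f2P t : t \in `[0, T] -> `|f2 t| <= P.
  by move=> /b2[b _ _]; rewrite (le_trans b)// /P; lra.
have df2P t : t \in `[0, T] -> `|df2 t| <= P.
  by move=> /b2[_ b _]; rewrite (le_trans b)// /P; lra.
have ddf2P t : t \in `[0, T] -> `|ddf2 t| <= P.
  by move=> /b2[_ _ b]; rewrite (le_trans b)// /P; lra.
clearbody P.
set n0 := vnorm psi0; have n00 : 0 <= n0 by exact: vnorm_ge0.
have psin t : t \in `[0, T] -> vnorm (psi t) = n0.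
  exact: evolution_isometry hH1 hH2 hU t.
(* [opnorm H1] serves only to show that the sets under [sup] are bounded; it does not enter the
   constant. *)
have H1psi t : t \in `[0, T] -> vnorm (H1 *m psi t) <= opnorm H1 * n0.
  by move=> tT; rewrite (le_trans (vnorm_mulmx _ _))// psin.
have psiS t : t \in `[0, T] -> vnorm (H1 *m psi t) <= S.
  move=> tT; apply: ub_le_sup; last by exists t.
  by exists (opnorm H1 * n0) => _ [s sT <-]; exact: H1psi.
have psiQ t : t \in `[0, T] -> Num.sqrt (n0 * vnorm (H1 *m psi t)) <= Ssqrt.
  move=> tT; apply: ub_le_sup; last by exists t.
  exists (Num.sqrt (n0 * (opnorm H1 * n0))) => _ [s sT <-].
  by rewrite ler_wsqrtr// ler_wpM2l// H1psi.
have T_0 : 0 \in `[0, T] by rewrite in_itv/= lexx ltW.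
have S0 : 0 <= S by rewrite (le_trans (vnorm_ge0 _) (psiS _ T_0)).
have Q0 : 0 <= Ssqrt by rewrite (le_trans (sqrtr_ge0 _) (psiQ _ T_0)).
have Dpsi t : t \in `[0, T] ->
    vnorm (D1 *m psi t) <= Num.sqrt (n0 * vnorm (H1 *m psi t)).
  by move=> tT; rewrite (le_trans (vnorm_factor HD _))// psin.
have DQ t : t \in `[0, T] -> vnorm (D1 *m psi t) <= Ssqrt.
  by move=> tT; rewrite (le_trans (Dpsi _ tT))// psiQ.
have DN t : t \in `[0, T] -> vnorm (D1 *m psi t) <= S + n0.
  move=> tT; have N0 : 0 <= S + n0 by rewrite addr_ge0.
  rewrite (le_trans (Dpsi _ tT))// -[leRHS](ger0_norm N0) -sqrtr_sqr.
  rewrite ler_wsqrtr// expr2 ler_pM ?vnorm_ge0//; first by rewrite lerDr.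
  by rewrite (le_trans (psiS _ tT))// lerDl.
have L0' : L%:R != 0 :> R by rewrite pnatr_eq0 -lt0n.
have h0 : 0 <= h by rewrite divr_ge0// ltW.
have hL : L%:R * h = T by rewrite /h mulrCA divff// mulr1.
have Lge0 : 0 <= L%:R :> R by [].
have e2 : T ^+ 2 / L%:R = L%:R * h ^+ 2 by rewrite -hL; field.
have e3 : T ^+ 3 / (L ^ 2)%:R = L%:R * h ^+ 3 by rewrite -hL natrX; field.
have psi_0 : psi 0 = psi0 by rewrite /psi; case: hU => -> _ _ _; rewrite mul1mx.
have hpsi : mdiff 0 T psi (fun s => - cI R *: (Ham f1 f2 H1 H2 s *m psi s)).
  apply: eq_mdiff (mdiffMr psi0 (evolution_mdiff hU)) => [//|s _].
  by rewrite -scalemxAl mulmxA.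
rewrite e2 e3 -/(psi T) -/n0 -{1 2 3 4}psi_0.
have inI t o : 0 <= t -> t + h <= T -> t <= o -> o <= t + h -> o \in `[0, T].
  by move=> t0 tT to oh; rewrite in_itv/= (le_trans t0 to) (le_trans oh tT).
have inIo t s : 0 <= t -> t + h <= T -> s \in `]t, t + h[ -> s \in `[0, T].
  by move=> t0 tT /[!in_itv]/= /andP[/ltW a /ltW b]; exact: inI t0 tT a b.
have th t : t <= t + h by rewrite lerDl.
have th2 t : t <= t + h / 2 by rewrite lerDl divr_ge0.
have th3 t : t + h / 2 <= t + h by rewrite lerD2l; move: h0; lra.
have hh t : t + h - t = h by rewrite addrAC subrr add0r.
have Ih t o : t <= o -> o <= t + h -> o \in `[t, t + h].
  by move=> a b; rewrite in_itv/= a b.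
have quad (F f df : R -> R) t s o : rdiff 0 T F f -> rdiff 0 T f df ->
    (forall t, t \in `[0, T] -> `|df t| <= P) -> 0 <= t -> t + h <= T ->
    s \in `[t, t + h] -> o \in `[t, t + h] ->
    `|F s - F o - f o * (s - o)| <= P * h ^+ 2.
  move=> hF hf hP t0 tT sI oI; rewrite -[X in P * X ^+ 2](hh t).
  apply: (quadrature1 (th t) P0 (rdiff_subset t0 tT hF) (rdiff_subset t0 tT hf)) => //.
  by move=> r rI; apply: hP; exact: inIo t0 tT rI.
have midp (F f df ddf : R -> R) t : rdiff 0 T F f -> rdiff 0 T f df ->
    rdiff 0 T df ddf -> (forall t, t \in `[0, T] -> `|ddf t| <= P) ->
    0 <= t -> t + h <= T ->
    `|F (t + h) - F t - f (t + h / 2) * h| <= P * h ^+ 3.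
  move=> hF hf hdf hP t0 tT.
  have := midpoint_rule (th t) P0 (rdiff_subset t0 tT hF)
    (rdiff_subset t0 tT hf) (rdiff_subset t0 tT hdf).
  rewrite hh; apply => r rI; apply: hP; exact: inIo t0 tT rI.
(* Stated for arbitrary propagators, so that nothing about the exponential series is used beyond
   this characterization. *)
have key E1 E2 : propagator H1 E1 -> propagator H2 E2 -> [/\
    vnorm (trotter (fun t => E1 0 *m (E2 (f2 (t + h) * h) *m E1 (f1 (t + h) * h)))
      h L *m psi 0 - psi T) <= Ct * (L%:R * h ^+ 2) * (S + n0),
    vnorm (trotter (fun t => E1 0 *m (E2 (Defs.Rint t (t + h) f2) *m
      E1 (Defs.Rint t (t + h) f1))) h L *m psi 0 - psi T)
      <= Ct * (L%:R * h ^+ 2) * (Ssqrt + n0),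
    vnorm (trotter (fun t => E1 (h / 2 * f1 (t + h / 2)) *m
      (E2 (h * f2 (t + h / 2)) *m E1 (h / 2 * f1 (t + h / 2)))) h L *m psi 0 - psi T)
      <= Ct * (L%:R * h ^+ 3) * (S + n0) &
    vnorm (trotter (fun t => E1 (Defs.Rint (t + h / 2) (t + h) f1) *m
      (E2 (Defs.Rint t (t + h) f2) *m E1 (Defs.Rint t (t + h / 2) f1)))
      h L *m psi 0 - psi T) <= Ct * (L%:R * h ^+ 3) * (S + n0)].
  move=> hE1 hE2.
  have G p q al := global_error (p := p) (q := q) (al := al) hH1 hH2 hE1 hE2
    (psi := psi) h0 hL.
  have O1 p q al := first_order_step (p := p) (q := q) (al := al) hH1 hH2 hE1 hE2
    HD hC1 C1_0 (ltW T0) P1 C1P H2P hF1 hF2 f1P f2P hpsi psin psiS h0.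
  have O2 p q al := second_order_step (p := p) (q := q) (al := al) hH1 hH2 hE1 hE2
    HD hC1 hC2 C1_0 C2_0 (ltW T0) P1 C1P C2P H2P hF1 hF2 r1 r2 f1P f2P df1P df2P
    hpsi psin psiS h0.
  have nle (a b c : R) : a = b -> `|b| <= c -> `|a| <= c by move=> ->.
  have nleN (a b c : R) : a = - b -> `|b| <= c -> `|a| <= c.
    by move=> ->; rewrite normrN.
  have fPh f t : (forall t, t \in `[0, T] -> `|f t| <= P) -> t \in `[0, T] ->
      `|f t * h| <= P * h.
    by move=> fP tI; rewrite normrM (ger0_norm h0) ler_wpM2r// fP.
  have F1h t s o : 0 <= t -> t + h <= T -> s \in `[t, t + h] ->
      o \in `[t, t + h] -> `|F1 s - F1 o| <= P * h.
    by move=> t0 tT; exact: (F1_lipschitz P1 hF1 f1P t0 tT).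
  split.
  (* Scheme (s,1): the right-endpoint rule has error [P h^2] for both angles, and
     [|D1 psi| <= S + n0]. *)
  - apply: le_trans (first_order_constant h P1 S0 n00 Lge0).
    apply: (G (fun=> 0) (fun t => f2 (t + h) * h) (fun t => f1 (t + h) * h)).
    move=> t t0 tT; have zI := Ih _ _ (th t) (lexx _); have tI := Ih _ _ (lexx _) (th t).
    apply: (O1 (fun=> 0) (fun t => f2 (t + h) * h) (fun t => f1 (t + h) * h)) => //.
    + by rewrite addr_ge0.
    + by apply: fPh => //; exact: inI t0 tT (th t) (lexx _).
    + by apply: nle (quad _ _ _ _ _ _ hF2 r2 df2P t0 tT tI zI); ring.
    + by apply: nle (quad _ _ _ _ _ _ hF1 r1 df1P t0 tT tI zI); ring.
  (* Scheme (g,1): the angles are exact integrals, so both quadrature errors are [0] and only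
     [Q = Ssqrt] remains. *)
  - apply: (@le_trans _ _ (L%:R * (2 * P ^+ 3 * (Ssqrt + n0) * h ^+ 2
      + 0 * (P * n0) + 0 * S))); last first.
      rewrite !mul0r !addr0 /Ct.
      have P3 : P ^+ 3 <= P ^+ 5 by rewrite ler_weXn2l.
      have P3' : 0 <= P ^+ 3 by rewrite exprn_ge0.
      have X0 : 0 <= L%:R * h ^+ 2 * (Ssqrt + n0).
        by rewrite mulr_ge0 ?addr_ge0// mulr_ge0// sqr_ge0.
      rewrite [leLHS](_ : _ = 2 * P ^+ 3 * (L%:R * h ^+ 2 * (Ssqrt + n0))); last by ring.
      rewrite -[leRHS]mulrA ler_wpM2r//; lra.
    apply: (G (fun=> 0) (fun t => Defs.Rint t (t + h) f2)
      (fun t => Defs.Rint t (t + h) f1)).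
    move=> t t0 tT; have zI := Ih _ _ (th t) (lexx _); have tI := Ih _ _ (lexx _) (th t).
    apply: (O1 (fun=> 0) (fun t => Defs.Rint t (t + h) f2)
      (fun t => Defs.Rint t (t + h) f1)) => //.
    + by rewrite F1E//; exact: F1h t0 tT zI tI.
    + by rewrite F2E// subrr normr0.
    + by rewrite F1E// add0r subrr normr0.
  (* Scheme (s,2): the half-step angle is a one-point rule with error [P h^2], while the full angles
     [p + al] and [q] follow the midpoint rule with error [P h^3]. *)
  - apply: le_trans (second_order_constant P1 S0 n00 Lge0 h0).
    apply: (G (fun t => h / 2 * f1 (t + h / 2)) (fun t => h * f2 (t + h / 2))
      (fun t => h / 2 * f1 (t + h / 2))).
    move=> t t0 tT; have oI := Ih _ _ (th2 t) (th3 t); have tI := Ih _ _ (lexx _) (th t).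
    have oT := inI _ _ t0 tT (th2 t) (th3 t).
    apply: (O2 (fun t => h / 2 * f1 (t + h / 2)) (fun t => h * f2 (t + h / 2))
      (fun t => h / 2 * f1 (t + h / 2))) => //.
    + have h2 : 0 <= h / 2 by rewrite divr_ge0.
      by rewrite normrM (ger0_norm h2) mulrC ler_pM ?f1P//; lra.
    + by apply: nle (quad _ _ _ _ _ _ hF1 r1 df1P t0 tT tI oI); ring.
    + by apply: nleN (midp _ _ _ _ _ hF2 r2 dr2 ddf2P t0 tT); ring.
    + by apply: nleN (midp _ _ _ _ _ hF1 r1 dr1 ddf1P t0 tT); field.
  (* Scheme (g,2): all three angle errors vanish, and are bounded by the same [P h^2] and [P h^3] as
     for (s,2). *)
  - apply: le_trans (second_order_constant P1 S0 n00 Lge0 h0).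
    apply: (G (fun t => Defs.Rint (t + h / 2) (t + h) f1)
      (fun t => Defs.Rint t (t + h) f2) (fun t => Defs.Rint t (t + h / 2) f1)).
    move=> t t0 tT; have oI := Ih _ _ (th2 t) (th3 t); have tI := Ih _ _ (lexx _) (th t).
    have oT : t + h / 2 <= T := le_trans (th3 t) tT.
    have o0' : 0 <= t + h / 2 := le_trans t0 (th2 t).
    apply: (O2 (fun t => Defs.Rint (t + h / 2) (t + h) f1)
      (fun t => Defs.Rint t (t + h) f2) (fun t => Defs.Rint t (t + h / 2) f1)) => //.
    + by rewrite F1E//; exact: F1h t0 tT oI tI.
    + by rewrite F1E// subrr normr0 mulr_ge0// sqr_ge0.
    + by rewrite F2E// subrr normr0 mulr_ge0// exprn_ge0.
    + by rewrite !F1E// subrKA subrr normr0 mulr_ge0// exprn_ge0.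
have [k1 k2 k3 k4] := key _ _ (expmi_propagator H1) (expmi_propagator H2).
have s1E : U_s1 f1 f2 H1 H2 h = fun t => expmi 0 H1 *m
    (expmi (f2 (t + h) * h) H2 *m expmi (f1 (t + h) * h) H1).
  by apply/funext => t; rewrite expmi0 mul1mx.
have g1E : U_g1 f1 f2 H1 H2 h = fun t => expmi 0 H1 *m
    (expmi (Defs.Rint t (t + h) f2) H2 *m expmi (Defs.Rint t (t + h) f1) H1).
  by apply/funext => t; rewrite expmi0 mul1mx.
have s2E : U_s2 f1 f2 H1 H2 h = fun t => expmi (h / 2 * f1 (t + h / 2)) H1 *m
    (expmi (h * f2 (t + h / 2)) H2 *m expmi (h / 2 * f1 (t + h / 2)) H1).
  by apply/funext => t; rewrite mulmxA.
have g2E : U_g2 f1 f2 H1 H2 h = fun t => expmi (Defs.Rint (t + h / 2) (t + h) f1) H1 *m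
    (expmi (Defs.Rint t (t + h) f2) H2 *m expmi (Defs.Rint t (t + h / 2) f1) H1).
  by apply/funext => t; rewrite mulmxA.
split; [rewrite s1E; exact: k1|rewrite g1E; exact: k2|rewrite s2E; exact: k3
  |rewrite g2E; exact: k4].
Qed.
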